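(* Let $S\subset M$ be a set of locally finite $\mathcal H^k$-measure and $x\in S$. Then $S$ has an approximate tangent space $T_xS$ at $x$ (a $k$-dimensional linear subspace of $T_xM$) if and only if for each chart $(U,\varphi)$ around $x$ one has $$\frac{(\phi_{\varphi(x),r}\circ\varphi)_*(\mathcal H^k_g\llcorner S)}{r^k}\ \longrightarrow\ (d\varphi_x)_*\big(\mathcal H^k_{g_x}\llcorner T_xS\big)\quad\text{weakly}^*\text{ on }\mathbb R^m\text{ as }r\downarrow0.$$
   Context: $M=(M,g)$ is a smooth, connected, oriented $m$-dimensional Riemannian manifold; chart domains are relatively compact. $\mathcal H^k_g$ is the $k$-dimensional Hausdorff measure of the Riemannian distance on $M$, $\mathcal H^k_{g_x}$ that of the inner product space $(T_xM,g_x)$, and $\mathcal H^k_e$ the Euclidean one. For $y\in\mathbb R^m$, $r>0$, $\phi_{y,r}(z)=(z-y)/r$. For a chart $(U,\varphi)$, $\varphi(S):=\varphi(S\cap U)$, and the pushforward under $\varphi$ is that of the restriction to $U$. Weak$^*$ convergence of measures on $\mathbb R^m$ is tested against $C_c(\mathbb R^m)$. Approximate tangent space: $\tilde S\subset\mathbb R^m$ has approximate tangent space $T_y\tilde S$ at $y$ if $T_y\tilde S$ is a $k$-dimensional subspace with $\mathcal H^k_e\llcorner\big(\tfrac{\tilde S-y}{r}\big)\to\mathcal H^k_e\llcorner T_y\tilde S$ weakly$^*$ as $r\downarrow0$. A set $S\subset M$ of locally finite $\mathcal H^k$-measure has approximate tangent space $T_xS$ at $x$ if for some (equivalently, any) chart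 $\varphi$ around $x$ the set $\varphi(S)$ has an approximate tangent space at $\varphi(x)$, and then $T_xS=(d\varphi^{-1})_{\varphi(x)}(T_{\varphi(x)}\varphi(S))$.
   Formalization: It is assumed for the given S and x that if the image of S has an approximate tangent space in some chart around x, it has one in every such chart; the ''equivalently, any'' of the definition fails for general sets of locally finite measure, and the claim fails without it. *)

(* Defs.v *)
From HB Require Import structures.
From mathcomp Require Import all_boot all_order all_algebra.
From mathcomp Require Import all_classical all_reals all_analysis.
Import Order.TTheory GRing.Theory Num.Theory.
Import numFieldNormedType.Exports.

Set Implicit Arguments.
Unset Strict Implicit.
Unset Printing Implicit Defensive.

Local Open Scope classical_set_scope.
Local Open Scope ring_scope.

(** * Hausdorff measures *)

Section Hausdorff.
Context {R : realType} {T : Type}.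
Local Open Scope ereal_scope.

(* volume of the unit ball of R^k: w_(k+2) = 2 pi / (k + 2) * w_k *)
Fixpoint unit_ball_volume (k : nat) : R :=
  match k with
  | 0%N => 1
  | 1%N => 2
  | k'.+2 => 2 * pi / k%:R * unit_ball_volume k'
  end%R.

Definition diameter (d : T -> T -> \bar R) (A : set T) : \bar R :=
  ereal_sup [set d p.1 p.2 | p in A `*` A].

(* The empty set is singled out because of k = 0: a nonempty set of diameter 0
   has 0-dimensional gauge 0 ^ 0 = 1. *)
Definition hausdorff_gauge (d : T -> T -> \bar R) (k : nat) (A : set T) :=
  if `[< A = set0 >] then 0
  else (unit_ball_volume k / 2 ^+ k)%:E * diameter d A ^+ k.

Definition hausdorff_premeasure (d : T -> T -> \bar R) (k : nat) (e : R)
    (A : set T) : \bar R :=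
  ereal_inf [set \sum_(0 <= i <oo) hausdorff_gauge d k (C i) |
    C in [set C : nat -> set T |
      A `<=` \bigcup_i C i /\ forall i, diameter d (C i) <= e%:E]].

(* outer measure on all subsets of T; it is countably additive on Borel sets
   when d is a distance, and so is its restriction to any set *)
Definition hausdorff (d : T -> T -> \bar R) (k : nat) (A : set T) : \bar R :=
  ereal_sup [set hausdorff_premeasure d k e A | e in [set e : R | (0 < e)%R]].

Definition mrestrict (mu : set T -> \bar R) (S : set T) : set T -> \bar R :=
  fun B => mu (S `&` B).

End Hausdorff.

(** * Measures on R^m and approximate tangent spaces of subsets of R^m *)

Section Euclidean.
Context {R : realType} {m : nat}.
Implicit Types (y z : 'rV[R]_m) (A : set 'rV[R]_m).

(* the library norm of 'rV[R]_m is the sup norm *)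
Definition edist y z : \bar R :=
  (Num.sqrt (\sum_i (y 0 i - z 0 i) ^+ 2))%:E.

Definition blowup y (r : R) z : 'rV[R]_m := r^-1 *: (z - y).

Definition borel_rV := g_sigma_algebraType (@open 'rV[R]_m).

Definition integral_rV (mu : set 'rV[R]_m -> \bar R) (f : 'rV[R]_m -> R) :
    \bar R :=
  integral (T := borel_rV) mu [set: borel_rV] (EFin \o f).

Definition weak_star_cvg (mu : R -> set 'rV[R]_m -> \bar R)
    (nu : set 'rV[R]_m -> \bar R) : Prop :=
  forall f : 'rV[R]_m -> R, continuous f ->
    compact (closure [set z | f z != 0]) ->
    integral_rV (mu r) f @[r --> 0^'+] --> integral_rV nu f.

Definition is_approx_tangent (k : nat) A y (T : {vspace 'rV[R]_m}) : Prop :=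
  \dim T = k /\
  weak_star_cvg
    (fun r => mrestrict (hausdorff edist k) (blowup y r @` A))
    (mrestrict (hausdorff edist k) [set` T]).

End Euclidean.

(** * Smooth maps and smooth manifolds *)

(* meaningful for an open set A *)
Fixpoint Cn_on {R : realType} {V W : normedModType R} (n : nat) (f : V -> W)
    (A : set V) : Prop :=
  match n with
  | 0%N => forall z, A z -> {for z, continuous f}
  | n'.+1 => (forall z, A z -> differentiable f z) /\
             (forall v, Cn_on n' (fun z => 'D_v f z) A)
  end.

Definition smooth_on {R : realType} {V W : normedModType R} (f : V -> W)
    (A : set V) : Prop := forall n, Cn_on n f A.

(* The values of chart_map outside chart_dom, and of chart_inv outside the image
   of the chart, are irrelevant. *)
Record chart (R : realType) (m : nat) (M : topologicalType) := Chart {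
  chart_dom : set M ;
  chart_map :> M -> 'rV[R]_m ;
  chart_inv : 'rV[R]_m -> M ;
  chart_dom_open : open chart_dom ;
  chart_relatively_compact : compact (closure chart_dom) ;
  chart_map_continuous : forall x, chart_dom x -> {for x, continuous chart_map} ;
  chart_img_open : open (chart_map @` chart_dom) ;
  chart_mapK : forall x, chart_dom x -> chart_inv (chart_map x) = x ;
  chart_inv_continuous :
    forall y, (chart_map @` chart_dom) y -> {for y, continuous chart_inv} }.

Definition transition {R : realType} {m : nat} {M : topologicalType}
  (phi psi : chart R m M) : 'rV[R]_m -> 'rV[R]_m := psi \o chart_inv phi.

Definition overlap {R : realType} {m : nat} {M : topologicalType}
  (phi psi : chart R m M) : set 'rV[R]_m :=
  phi @` (chart_dom phi `&` chart_dom psi).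

Definition smoothly_compatible {R : realType} {m : nat} {M : topologicalType}
    (phi psi : chart R m M) : Prop :=
  smooth_on (transition phi psi) (overlap phi psi) /\
  smooth_on (transition psi phi) (overlap psi phi).

(* the atlas is the maximal one, among charts with relatively compact domain *)
Record smoothManifold (R : realType) (m : nat) := SmoothManifold {
  manifold_carrier :> topologicalType ;
  manifold_hausdorff : hausdorff_space manifold_carrier ;
  manifold_second_countable : @second_countable manifold_carrier ;
  atlas : set (chart R m manifold_carrier) ;
  atlas_cover : forall x, exists2 phi, atlas phi & chart_dom phi x ;
  atlas_compatible : forall phi psi, atlas phi -> atlas psi ->
    smoothly_compatible phi psi ;
  atlas_maximal : forall phi,
    (forall psi, atlas psi -> smoothly_compatible phi psi) -> atlas phi }.

Record orientation (R : realType) (m : nat) (M : smoothManifold R m) :=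
  Orientation {
    positive_chart : set (chart R m M) ;
    positive_chart_atlas : positive_chart `<=` @atlas R m M ;
    positive_chart_cover :
      forall x, exists2 phi, positive_chart phi & chart_dom phi x ;
    positive_chart_det : forall phi psi,
      positive_chart phi -> positive_chart psi ->
      forall y, overlap phi psi y -> 0 < \det ('J (transition phi psi) y) }.

(** * Tangent spaces *)

Section Tangent.
Context {R : realType} {m : nat} {M : smoothManifold R m}.
Implicit Types (x : M) (phi psi chi : chart R m M) (u : 'rV[R]_m).

Definition charts_at x : set (chart R m M) :=
  [set phi | atlas phi /\ chart_dom phi x].

(* A tangent vector at x is the family of its coordinate vectors in all the
   charts around x, related by the differentials of the transition maps; it is
   extended by 0 to the other charts. *)
Definition tangent_pred x : {pred chart R m M -> 'rV[R]_m} :=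
  fun v => `[< (forall phi, ~ charts_at x phi -> v phi = 0) /\
    (forall phi psi, charts_at x phi -> charts_at x psi ->
       v psi = 'd (transition phi psi) (phi x) (v phi)) >].

Lemma tangent_submod_closed x : submod_closed (tangent_pred x).
Proof.
split.
  by apply/asboolP; split=> // phi psi _ _; rewrite linear0.
move=> a v w /asboolP[v0 vE] /asboolP[w0 wE]; apply/asboolP; split.
  by move=> phi h; rewrite /= !fctE v0 // w0 // scaler0 addr0.
move=> phi psi hphi hpsi.
by rewrite !fctE (vE phi) // (wE phi) // linearP.
Qed.

HB.instance Definition _ x :=
  GRing.isSubmodClosed.Build R (chart R m M -> 'rV[R]_m) (tangent_pred x)
    (tangent_submod_closed x).

Record tangent x := Tangent {
  tangent_coord :> chart R m M -> 'rV[R]_m ;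
  tangent_coordP : tangent_coord \in tangent_pred x }.

HB.instance Definition _ x := [isSub for @tangent_coord x].
HB.instance Definition _ x := [Choice of tangent x by <:].
HB.instance Definition _ x :=
  [SubChoice_isSubZmodule of tangent x by <:].
HB.instance Definition _ x :=
  [SubZmodule_isSubLmodule of tangent x by <:].


Lemma near_overlap x phi psi : charts_at x phi -> charts_at x psi ->
  \forall y \near phi x, (phi @` chart_dom phi) y /\
                         chart_dom psi (chart_inv phi y).
Proof.
move=> [_ xphi] [_ xpsi].
have img : (phi @` chart_dom phi) (phi x) by exists x.
have dphi : nbhs (phi x) (phi @` chart_dom phi).
  by apply: open_nbhs_nbhs; split; first exact: chart_img_open.
have dpsi : nbhs (chart_inv phi (phi x)) (chart_dom psi).
  rewrite chart_mapK //; apply: open_nbhs_nbhs; split => //.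
  exact: chart_dom_open.
exact: filterI dphi (chart_inv_continuous img dpsi).
Qed.

Lemma transition_differentiable x phi psi :
  charts_at x phi -> charts_at x psi ->
  differentiable (transition phi psi) (phi x).
Proof.
move=> [aphi xphi] [apsi xpsi].
have [/(_ 1%N)[+ _] _] := atlas_compatible aphi apsi.
by apply; exists x.
Qed.

Lemma transitionE x phi psi : charts_at x phi ->
  transition phi psi (phi x) = psi x.
Proof. by move=> [_ xphi]; rewrite /transition /= chart_mapK. Qed.

Lemma diff_transition_comp x phi psi chi u :
  charts_at x phi -> charts_at x psi -> charts_at x chi ->
  'd (transition psi chi) (psi x) ('d (transition phi psi) (phi x) u) =
  'd (transition phi chi) (phi x) u.
Proof.
move=> hphi hpsi hchi.
have d1 := transition_differentiable hphi hpsi.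
have d2 := transition_differentiable hpsi hchi.
have d3 := transition_differentiable hphi hchi.
have d2' : differentiable (transition psi chi) (transition phi psi (phi x)).
  by rewrite (transitionE psi hphi).
have E : 'd (transition psi chi) (psi x) ('d (transition phi psi) (phi x) u) =
         'd (transition psi chi \o transition phi psi) (phi x) u.
  apply: esym; apply: (etrans (congr1 (fun h => h u) (diff_comp d1 d2'))).
  by rewrite /= (transitionE psi hphi).
apply: (etrans E).
apply: (etrans (esym (deriveE u (differentiable_comp d1 d2')))).
apply: (etrans _ (deriveE u d3)).
apply: near_eq_derive.
have := near_overlap hphi hpsi; apply: filterS => y [_ hy].
by rewrite /transition /= chart_mapK.
Qed.

Lemma diff_transition_id x phi u : charts_at x phi ->
  'd (transition phi phi) (phi x) u = u.
Proof.
move=> hphi.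
apply: (etrans (esym (deriveE u (transition_differentiable hphi hphi)))).
apply: (etrans _ (derive_id (phi x) u)); apply: near_eq_derive.
have := near_overlap hphi hphi; apply: filterS => _ [[z hz <-] _].
by rewrite /transition /= chart_mapK.
Qed.

Definition vec_of_coord_fun phi x u : chart R m M -> 'rV[R]_m := fun psi =>
  if `[< charts_at x phi /\ charts_at x psi >]
  then 'd (transition phi psi) (phi x) u else 0.

Lemma vec_of_coord_subproof phi x u : vec_of_coord_fun phi x u \in tangent_pred x.
Proof.
rewrite /vec_of_coord_fun; apply/asboolP; split=> [psi npsi|psi chi hpsi hchi].
  by case: asboolP => // -[].
have [hphi|nphi] := pselect (charts_at x phi).
  rewrite asboolT // asboolT //.
  exact: esym (diff_transition_comp u hphi hpsi hchi).
rewrite asboolF; last by case.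
rewrite asboolF; last by case.
by rewrite linear0.
Qed.

(* the vector at x with coordinates u in the chart phi, that is
   \sum_i u_i (d/dphi_i); it is 0 when phi is not a chart around x *)
Definition vec_of_coord phi x u : tangent x :=
  Tangent (vec_of_coord_subproof phi x u).

Lemma vec_of_coordK phi x u : charts_at x phi -> vec_of_coord phi x u phi = u.
Proof.
move=> hphi; rewrite /= /vec_of_coord_fun asboolT //.
exact: diff_transition_id.
Qed.

Lemma tangent_coordK phi x (v : tangent x) : charts_at x phi ->
  vec_of_coord phi x (v phi) = v.
Proof.
move=> hphi; apply/val_inj/funext => psi; rewrite /= /vec_of_coord_fun.
have /asboolP[v0 vE] := tangent_coordP v.
case: asboolP => [[_ hpsi]|h]; first exact: esym (vE phi psi hphi hpsi).
by rewrite v0 // => hpsi; exact: h.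
Qed.

Definition chart_around x : chart R m M := s2val (cid2 (atlas_cover x)).

Lemma chart_aroundP x : charts_at x (chart_around x).
Proof. by rewrite /chart_around; case: cid2. Qed.

Lemma tangent_vect_axiom x : Vector.axiom m (tangent x).
Proof.
exists (fun v : tangent x => v (chart_around x)) => //.
exists (vec_of_coord (chart_around x) x) => u.
  exact/tangent_coordK/chart_aroundP.
exact/vec_of_coordK/chart_aroundP.
Qed.

HB.instance Definition _ x :=
  Lmodule_hasFinDim.Build R (tangent x) (tangent_vect_axiom x).

(* the differential d(phi)_x : T_x M -> R^m *)
Definition chart_diff phi x : 'Hom(tangent x, 'rV[R]_m) :=
  linfun (fun v : tangent x => v phi).

Lemma chart_diffE phi x (v : tangent x) : chart_diff phi x v = v phi.
Proof.
pose f (v : tangent x) := v phi.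
have f_lin : linear f by [].
pose F := GRing.isLinear.Build R (tangent x) 'rV[R]_m *:%R f f_lin.
pose L : {linear tangent x -> 'rV[R]_m} := HB.pack f F.
by rewrite /chart_diff -/(f : _ -> _) (lfunE L).
Qed.

End Tangent.

Arguments tangent {R m} M x.

(** * Riemannian metrics and their distance *)

Record riemannianMetric (R : realType) (m : nat) (M : smoothManifold R m) :=
  RiemannianMetric {
    metric : forall x : M, tangent M x -> tangent M x -> R ;
    metric_linear : forall x (w : tangent M x) a u v,
      metric (a *: u + v) w = a * metric u w + metric v w ;
    metric_sym : forall x (u v : tangent M x), metric u v = metric v u ;
    metric_pos : forall x (v : tangent M x), v != 0 -> 0 < metric v v ;
    metric_smooth : forall phi, atlas phi -> forall u w : 'rV[R]_m,
      smooth_on (fun y => metric (vec_of_coord phi (chart_inv phi y) u)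
                                 (vec_of_coord phi (chart_inv phi y) w) : R)
                (phi @` chart_dom phi) }.

Section Distance.
Context {R : realType} {m : nat} {M : smoothManifold R m}.
Variable g : riemannianMetric M.

Definition tangent_norm (x : M) (v : tangent M x) : R := Num.sqrt (metric g v v).

Definition tangent_dist (x : M) (v w : tangent M x) : \bar R :=
  (tangent_norm (v - w))%:E.

(* C^1 on a neighbourhood of [0, 1] *)
Definition C1_path (c : R -> M) : Prop :=
  exists2 e : R, 0 < e & forall s, - e < s < 1 + e ->
    {for s, continuous c} /\
    forall phi, charts_at (c s) phi ->
      derivable (phi \o c) s 1 /\ {for s, continuous (derive1 (phi \o c))}.

(* independent of the chart when c is differentiable at s *)
Definition velocity (c : R -> M) (s : R) : tangent M (c s) :=
  let phi := chart_around (c s) in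
  vec_of_coord phi (c s) (derive1 (phi \o c) s).

Definition path_length (c : R -> M) : \bar R :=
  \int[lebesgue_measure]_(s in `[0%R, 1%R]) (tangent_norm (velocity c s))%:E.

(* A piecewise C^1 path is the list of its C^1 pieces, each of them
   parametrized by [0, 1]. *)
Fixpoint piecewise_C1_path (x : M) (p : seq (R -> M)) (y : M) : Prop :=
  match p with
  | [::] => x = y
  | c :: p' => [/\ C1_path c, c 0 = x & piecewise_C1_path (c 1) p' y]
  end.

Definition riemannian_dist (x y : M) : \bar R :=
  ereal_inf [set (\sum_(c <- p) path_length c)%E |
    p in [set p | piecewise_C1_path x p y]].

End Distance.

(** * Approximate tangent spaces of subsets of M *)

Section ApproximateTangent.
Context {R : realType} {m : nat} {M : smoothManifold R m}.
Implicit Types (S : set M) (x : M) (phi : chart R m M).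

Definition chart_image phi S : set 'rV[R]_m := phi @` (S `&` chart_dom phi).

Definition has_approx_tangent_in (k : nat) phi S x : Prop :=
  exists T : {vspace 'rV[R]_m},
    is_approx_tangent k (chart_image phi S) (phi x) T.

(* The definition of an approximate tangent space of S at x through "some
   (equivalently, any)" chart presupposes this property of S and x. It does not
   hold for all S: in R^2, the union S of the origin and of the vertical segments
   {+-1/n} x [0, 1/(n (n + 1))] has the horizontal axis as approximate tangent
   space at 0 in the chart (a, b), and none in the chart (a, 2 b), where the
   blow-ups of H^1 converge to twice H^1 on the axis. *)
Definition approx_tangent_chart_independent (k : nat) S x : Prop :=
  (exists2 phi, charts_at x phi & has_approx_tangent_in k phi S x) ->
  forall phi, charts_at x phi -> has_approx_tangent_in k phi S x.

Definition has_approx_tangent (k : nat) S x (T : {vspace tangent M x}) : Prop :=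
  exists phi (T' : {vspace 'rV[R]_m}),
    [/\ charts_at x phi, is_approx_tangent k (chart_image phi S) (phi x) T' &
        T = ((chart_diff phi x)^-1 @: T')%VS].

Variable g : riemannianMetric M.

Definition locally_finite_hausdorff (k : nat) S : Prop :=
  forall z : M, exists2 V, nbhs z V &
    (hausdorff (riemannian_dist g) k (S `&` V) < +oo)%E.

Definition rescaled_pushforward (k : nat) phi S x (r : R) :
    set 'rV[R]_m -> \bar R := fun B =>
  ((r ^- k)%:E * mrestrict (hausdorff (riemannian_dist g) k) S
     (chart_dom phi `&` (blowup (phi x) r \o phi) @^-1` B))%E.

Definition tangent_pushforward (k : nat) phi x (T : {vspace tangent M x}) :
    set 'rV[R]_m -> \bar R := fun B =>
  mrestrict (hausdorff (@tangent_dist _ _ _ g x) k) [set` T]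
    (chart_diff phi x @^-1` B).

End ApproximateTangent.

(* Main.v *)
Require Import Defs.
From HB Require Import structures.
From mathcomp Require Import all_boot all_order all_algebra.
From mathcomp Require Import all_classical all_reals all_analysis.
From mathcomp Require Import ring lra.
Import Order.TTheory GRing.Theory Num.Theory.
Import numFieldNormedType.Exports.

Set Implicit Arguments.
Unset Strict Implicit.
Unset Printing Implicit Defensive.

Local Open Scope classical_set_scope.
Local Open Scope ring_scope.

(** Every chart phi around x can be composed with an invertible matrix so as to
    become a chart psi in which g_x is the standard inner product
    ([isometric_chart_exists], by Cholesky factorization of the Gram matrix).
    Near x the coefficients of g in psi are close to those of the identity,
    hence the Riemannian distance of two points is the Euclidean distance of
    their coordinates up to a factor as close to 1 as desired
    ([isometric_chart_pinched], [riemannian_dist_le] for which a coordinate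
    segment is a competitor, and [riemannian_dist_ge]: a curve that stays in a
    coordinate ball is at least as long as its coordinate increment, and one
    that leaves the ball is longer than the bound to be proved). Hausdorff
    measures obey the same comparison, so that at a small scale r the blow-ups
    of H_g restricted to S and of H_e restricted to psi(S) have ratio close to
    1, uniformly on the subsets of a fixed ball ([locally_asymp_equiv_chart]).
    They therefore have the same weak limits ([weak_star_cvg_asymp_equiv]). As
    d(psi)_x is an isometry, the limit in the theorem is H_e restricted to
    d(psi)_x(T) ([tangent_pushforward_isometric]). In the chart psi the two
    conditions thus coincide, and the convergence passes from psi to phi by
    linearity ([weak_star_cvg_linear_chart]).

    One point remains for the direct implication: S has an approximate tangent
    space T0 in some chart phi0, hence also some T2 in psi, and T2 has to be
    the image T1 of T0 under the differential of the transition map. Blow-ups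
    in the two charts dominate each other up to a constant and up to this
    differential, so that the limit measure in psi cannot charge a
    neighbourhood of a point off T1 ([approx_tangent_support]). If T2 differs
    from T1, then H_e restricted to T2 vanishes near a point of T2. By
    translations, dilations and linear maps H_e then vanishes on the bounded
    parts of all subspaces of dimension k ([integral_null_subspace]), and both
    spaces give the limit 0.

    Integrals are handled as suprema of integrals of simple functions. An
    inequality between two set functions on the subsets of the set where f is
    positive passes to the integrals of f term by term ([nnint_transfer]); this
    single fact gives the comparison of blow-ups, the changes of variables and
    the estimates of the supports. *)

(** * Integrals against nonnegative set functions *)

Section NonnegIntegral.
Local Open Scope ereal_scope.
Import HBNNSimple.
Context {R : realType}.

(** The supremum inside the definition of the Lebesgue integral, for an
    arbitrary set function. *)
Definition nnint d (T : measurableType d) (mu : set T -> \bar R)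
    (f : T -> \bar R) : \bar R :=
  ereal_sup [set sintegral mu h |
    h in [set h : {nnsfun T >-> R} | forall x, (h x)%:E <= f x]].

Lemma integral_nnint d (T : measurableType d) (mu : set T -> \bar R)
    (f : T -> \bar R) :
  integral mu setT f = nnint mu f^\+ - nnint mu f^\-.
Proof. by rewrite /integral patch_setT. Qed.

Lemma nnint_ge0 d (T : measurableType d) (mu : set T -> \bar R)
    (f : T -> \bar R) :
  mu set0 = 0 -> (forall x, 0 <= f x) -> 0 <= nnint mu f.
Proof.
move=> mu0 f0; apply: ereal_sup_ubound; exists (@nnsfun0 _ T R) => //.
rewrite /sintegral fsbig1// => x _; have [->|x0] := eqVneq x 0%R.
  by rewrite mul0e.
rewrite (_ : _ @^-1` _ = set0) ?mu0 ?mule0// -subset0 => y /= y0.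
by move: x0; rewrite -y0 eqxx.
Qed.

(** A simple function below f, composed with L and cut off outside D, is a
    simple function below f'; the two integrals are finite sums that compare
    term by term, since a level set at a positive value lies in the set where f
    is positive. For L the identity this compares two set functions, for D the
    whole space it is a change of variables. *)
Lemma nnint_transfer d (T : measurableType d) d' (T' : measurableType d')
    (nu : set T -> \bar R) (mu : set T' -> \bar R) (L : T' -> T) (D : set T')
    (C : R) (f : T -> \bar R) (f' : T' -> \bar R) :
  (0 <= C)%R -> nu set0 = 0 -> mu set0 = 0 ->
  (forall B, 0 <= mu B) -> (forall w, 0 <= f' w) ->
  measurable D ->
  (forall B, measurable B -> measurable (D `&` L @^-1` B)) ->
  (forall B, measurable B -> B `<=` [set z | 0 < f z] ->
     nu B <= C%:E * mu (D `&` L @^-1` B)) ->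
  (forall w, D w -> f (L w) <= f' w) ->
  nnint nu f <= C%:E * nnint mu f'.
Proof.
move=> C0 nu0 mu0 mu_ge0 f'0 mD mL numu ff'.
apply: ge_ereal_sup => _ [h /= hf <-].
pose h'f : T' -> R := fun w => (if w \in D then h (L w) else 0)%R.
have fimh' : finite_set (range h'f).
  apply: (@sub_finite_set _ _ (range h `|` [set 0%R])).
    move=> _ [w _ <-]; rewrite /h'f; case: ifP => _; [left|right] => //.
  by rewrite finite_setU; split=> //; exact: fimfunP.
have mh' : measurable_fun setT h'f.
  have E : h'f = (h \o L) \_ D by apply/funext => w; rewrite patchE.
  rewrite E; apply/(measurable_restrictT _ mD).
  move=> _ Y mY; rewrite comp_preimage; apply: mL.
  by rewrite -[X in measurable X]setTI; exact: measurable_funPT.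
have h'0 w : (0 <= h'f w)%R by rewrite /h'f; case: ifP.
pose M1 := @isMeasurableFun.Build _ _ _ _ h'f mh'.
pose M2 := @FiniteImage.Build _ _ h'f fimh'.
pose M3 := @isNonNegFun.Build _ _ h'f h'0.
pose h' : {nnsfun T' >-> R} := HB.pack h'f M1 M2 M3.
have h'le : [set h : {nnsfun T' >-> R} | forall x, (h x)%:E <= f' x] h'.
  move=> w /=; rewrite /h'f; case: ifPn => [|_]; last exact: f'0.
  by rewrite inE => Dw; exact: le_trans (hf _) (ff' _ Dw).
apply: (@le_trans _ _ (C%:E * sintegral mu h')); last first.
  by apply: lee_wpmul2l; rewrite ?lee_fin//; apply: ereal_sup_ubound; exists h'.
have ple x : (0 < x)%R ->
    nu (h @^-1` [set x]) <= C%:E * mu (h'f @^-1` [set x]).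
  move=> x0.
  have mB : measurable (h @^-1` [set x]).
    by rewrite -[X in measurable X]setTI; exact: measurable_funPT.
  have Bf : h @^-1` [set x] `<=` [set z | 0 < f z].
    by move=> z /= hz; apply: lt_le_trans (hf z); rewrite hz lte_fin.
  apply: le_trans (numu _ mB Bf) _.
  rewrite (_ : h'f @^-1` _ = D `&` L @^-1` (h @^-1` [set x]))//.
  apply/seteqP; split=> w /=; rewrite /h'f.
    by case: ifPn => [|_ x00]; rewrite ?inE//; move: x0; rewrite -x00 ltxx.
  by case=> Dw; rewrite mem_set.
have fin : finite_set (range h) by exact: fimfunP.
rewrite /sintegral -(fsbig_widen (range h) setT)//=; last first.
  move=> x [_ /= nhx]; rewrite (_ : h @^-1` _ = set0) ?nu0 ?mule0//.
  by rewrite -subset0 => z /= hz; apply: nhx; exists z.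
rewrite -(fsbig_widen (range h) setT)//=; last first.
  move=> x [_ /= nhx]; have [->|x0] := eqVneq x 0%R; first by rewrite mul0e.
  rewrite (_ : h'f @^-1` _ = set0) ?mu0 ?mule0//.
  rewrite -subset0 => w /=; rewrite /h'f; case: ifPn => [_ hw|_ x00].
    by apply: nhx; exists (L w).
  by move: x0; rewrite -x00 eqxx.
rewrite ge0_mule_fsumr//; last first.
  move=> x; have [x0|x0] := leP 0%R x; first by rewrite mule_ge0.
  rewrite (_ : h'f @^-1` _ = set0) ?mu0 ?mule0//.
  by rewrite -subset0 => w /= hw; move: (h'0 w); rewrite hw leNgt x0.
apply: lee_fsum => // _ [z _ <-].
have : (0 <= h z)%R by [].
rewrite le_eqVlt => /predU1P[<-|hz0]; first by rewrite !mul0e mule0.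
by rewrite muleCA; apply: lee_wpmul2l; [rewrite lee_fin ltW|exact: ple].
Qed.
End NonnegIntegral.

(** * Hausdorff measures under Lipschitz maps *)

Section HausdorffLipschitz.
Context {R : realType}.
Local Open Scope ereal_scope.

Lemma unit_ball_volume_ge0 k : (0 <= unit_ball_volume k :> R)%R.
Proof.
suff: (0 <= unit_ball_volume k :> R)%R /\ (0 <= unit_ball_volume k.+1 :> R)%R.
  by case.
elim: k => [|k [ih1 ih2]]; first by split=> /=.
split=> //; rewrite [unit_ball_volume _]/=.
by rewrite mulr_ge0// divr_ge0// mulr_ge0// pi_ge0.
Qed.

Lemma diameter_ge0 (T : Type) (d : T -> T -> \bar R) (A : set T) x :
  (forall x y, 0 <= d x y) -> A x -> 0 <= diameter d A.
Proof.
move=> d0 Ax; apply: (le_trans (d0 x x)); apply: ereal_sup_ubound.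
by exists (x, x).
Qed.

Lemma hausdorff_gauge_ge0 (T : Type) (d : T -> T -> \bar R) k (A : set T) :
  (forall x y, 0 <= d x y) -> 0 <= hausdorff_gauge d k A.
Proof.
move=> d0; rewrite /hausdorff_gauge; case: asboolP => // /eqP/set0P[x Ax].
apply: mule_ge0.
  by rewrite lee_fin divr_ge0// ?unit_ball_volume_ge0// exprn_ge0.
by apply: expe_ge0; exact: diameter_ge0 Ax.
Qed.

Lemma hausdorff_premeasure_ge0 (T : Type) (d : T -> T -> \bar R) k e A :
  (forall x y, 0 <= d x y) -> 0 <= hausdorff_premeasure d k e A.
Proof.
move=> d0; apply: le_ereal_inf_tmp => _ [C _ <-].
by apply: nneseries_ge0 => i _ _; exact: hausdorff_gauge_ge0.
Qed.

Lemma hausdorff_ge0 (T : Type) (d : T -> T -> \bar R) k A :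
  (forall x y, 0 <= d x y) -> 0 <= hausdorff d k A.
Proof.
move=> d0; apply: le_trans (ereal_sup_ubound _); last by exists 1%R => /=.
exact: hausdorff_premeasure_ge0.
Qed.

Lemma hausdorff0 (T : Type) (d : T -> T -> \bar R) k :
  (forall x y, 0 <= d x y) -> hausdorff d k set0 = 0.
Proof.
move=> d0; apply/eqP; rewrite eq_le hausdorff_ge0// andbT.
apply: ge_ereal_sup => _ [e /= e0 <-]; apply: ereal_inf_lbound.
exists (fun _ => set0).
  split; first exact: sub0set.
  move=> i; rewrite /diameter (_ : [set _ | _ in _] = set0) ?ereal_sup0 ?leNye//.
  by rewrite -subset0 => _ [p [[]]].
apply: eseries0 => i _ _.
by rewrite /hausdorff_gauge asboolT.
Qed.

Lemma hausdorff_le (T : Type) (d : T -> T -> \bar R) k A B :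
  A `<=` B -> hausdorff d k A <= hausdorff d k B.
Proof.
move=> AB; apply: ge_ereal_sup => _ [e /= e0 <-].
apply: le_trans (ereal_sup_ubound _); last by exists e.
apply: le_ereal_inf => _ [C [BC Ce] <-]; exists C => //; split=> //.
exact: subset_trans BC.
Qed.

(** A cover of A is replaced by the images of its traces on A: their diameters
    are at most c times the original ones, because only distances between
    points of A intervene. *)
Lemma hausdorff_lipschitz (T T' : Type) (d : T -> T -> \bar R)
    (d' : T' -> T' -> \bar R) k (f : T -> T') (c : R) (A : set T) :
  (forall x y, 0 <= d x y) -> (forall x y, 0 <= d' x y) -> (0 < c)%R ->
  (forall x y, A x -> A y -> d' (f x) (f y) <= c%:E * d x y) ->
  hausdorff d' k (f @` A) <= (c ^+ k)%:E * hausdorff d k A.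
Proof.
move=> d0 d'0 c0 lip; have ck0 : (0 < c ^+ k)%R by rewrite exprn_gt0.
apply: ge_ereal_sup => _ [e /= e0 <-].
apply: (@le_trans _ _ ((c ^+ k)%:E * hausdorff_premeasure d k (e / c) A));
    last first.
  apply: lee_wpmul2l; first by rewrite lee_fin ltW.
  by apply: ereal_sup_ubound; exists (e / c)%R => //=; rewrite divr_gt0.
rewrite -lee_pdivrMl//; apply: le_ereal_inf_tmp => _ [C [AC Ce] <-].
rewrite lee_pdivrMl//.
have diamle i x : C i x -> A x ->
    diameter d' (f @` (C i `&` A)) <= c%:E * diameter d (C i).
  move=> Cx Ax; apply: ge_ereal_sup.
  move=> _ [[u v] /= [[y [Cy Ay] <-] [z [Cz Az] <-]] <-].
  apply: (le_trans (lip _ _ Ay Az)); apply: lee_wpmul2l.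
    by rewrite lee_fin ltW.
  by apply: ereal_sup_ubound; exists (y, z).
apply: (@le_trans _ _ (\sum_(0 <= i <oo)
    hausdorff_gauge d' k (f @` (C i `&` A)))).
  apply: ereal_inf_lbound; exists (fun i => f @` (C i `&` A)) => //; split.
    by move=> _ [x Ax <-]; have [i _ Cix] := AC _ Ax; exists i => //; exists x.
  move=> i; have [CA0|/set0P[x [Cx Ax]]] := eqVneq (C i `&` A) set0.
    rewrite CA0 image_set0 /diameter.
    rewrite (_ : [set _ | _ in _] = set0) ?ereal_sup0 ?leNye//.
    by rewrite -subset0 => _ [p [[]]].
  apply: (le_trans (diamle i x Cx Ax)).
  by rewrite -(@lee_pdivlMl _ c)// muleC -EFinM; exact: Ce.
rewrite -nneseriesZl//; last by move=> i _; exact: hausdorff_gauge_ge0.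
apply: lee_nneseries => [i _ _|i _]; first exact: hausdorff_gauge_ge0.
have [CA0|/set0P[x [Cx Ax]]] := eqVneq (C i `&` A) set0.
  rewrite {1}/hausdorff_gauge CA0 image_set0 asboolT//.
  by apply: mule_ge0; [rewrite lee_fin ltW|exact: hausdorff_gauge_ge0].
rewrite /hausdorff_gauge asboolF; last first.
  by move/eqP; apply/negP/set0P; exists (f x); exists x.
rewrite asboolF; last by move/eqP; apply/negP/set0P; exists x.
rewrite muleCA; apply: lee_wpmul2l.
  by rewrite lee_fin divr_ge0// ?unit_ball_volume_ge0// exprn_ge0.
have D0 : 0 <= diameter d (C i) by apply: diameter_ge0 Cx.
have D'0 : 0 <= diameter d' (f @` (C i `&` A)).
  by apply: (@diameter_ge0 _ _ _ (f x)) => //; exists x.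
elim: k {ck0} => [|n ih]; first by rewrite !expe0 mule1.
rewrite !expeS exprS EFinM muleACA; apply: lee_pmul => //.
  exact: expe_ge0.
exact: diamle Cx Ax.
Qed.

Lemma hausdorff_le_lipschitz (T T' : Type) (d : T -> T -> \bar R)
    (d' : T' -> T' -> \bar R) k (f : T -> T') (c : R) (A : set T) (B : set T') :
  (forall x y, 0 <= d x y) -> (forall x y, 0 <= d' x y) -> (0 < c)%R ->
  (forall x y, A x -> A y -> d' (f x) (f y) <= c%:E * d x y) ->
  B `<=` f @` A ->
  hausdorff d' k B <= (c ^+ k)%:E * hausdorff d k A.
Proof.
move=> d0 d'0 c0 lip /(hausdorff_le d' k) BA; apply: (le_trans BA).
exact: hausdorff_lipschitz.
Qed.

End HausdorffLipschitz.

(** * The Euclidean norm *)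

Section EuclideanNorm.
Context {R : realType}.

Definition dot m (u v : 'rV[R]_m) : R := \sum_i u 0 i * v 0 i.
Definition enorm m (u : 'rV[R]_m) : R := Num.sqrt (\sum_i u 0 i ^+ 2).

Lemma edistE m (y z : 'rV[R]_m) : Defs.edist y z = (enorm (y - z))%:E.
Proof.
rewrite /Defs.edist /enorm; congr (Num.sqrt _)%:E.
by apply: eq_bigr => i _; rewrite !mxE.
Qed.

Lemma enorm_ge0 m (u : 'rV[R]_m) : 0 <= enorm u.
Proof. exact: sqrtr_ge0. Qed.

Lemma sqr_enorm m (u : 'rV[R]_m) : enorm u ^+ 2 = dot u u.
Proof.
rewrite sqr_sqrtr; first by apply: eq_bigr => i _; rewrite expr2.
by apply: sumr_ge0 => i _; exact: sqr_ge0.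
Qed.

Lemma enorm0 m : enorm (0 : 'rV[R]_m) = 0.
Proof.
rewrite /enorm big1 ?sqrtr0// => i _.
by rewrite mxE expr0n.
Qed.

Lemma le_coord_enorm m (u : 'rV[R]_m) i : `|u 0 i| <= enorm u.
Proof.
rewrite -(@ler_pXn2r _ 2)// ?nnegrE ?enorm_ge0// sqr_enorm.
rewrite real_normK ?num_real// /dot (bigD1 i)//= -expr2 lerDl.
by apply: sumr_ge0 => j _; rewrite -expr2 sqr_ge0.
Qed.

Lemma enorm_eq0 m (u : 'rV[R]_m) : enorm u = 0 -> u = 0.
Proof.
move=> u0; apply/rowP => i; rewrite mxE; apply/eqP.
by rewrite -normr_le0 -u0 le_coord_enorm.
Qed.

Lemma enormZ m a (u : 'rV[R]_m) : enorm (a *: u) = `|a| * enorm u.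
Proof.
rewrite /enorm -sqrtr_sqr -sqrtrM ?sqr_ge0// mulr_sumr.
by congr Num.sqrt; apply: eq_bigr => i _; rewrite mxE exprMn.
Qed.

Lemma enormN m (u : 'rV[R]_m) : enorm (- u) = enorm u.
Proof. by rewrite -scaleN1r enormZ normrN1 mul1r. Qed.

Lemma enormB m (u v : 'rV[R]_m) : enorm (u - v) = enorm (v - u).
Proof. by rewrite -enormN opprB. Qed.

Lemma dot_le m (u v : 'rV[R]_m) : dot u v <= enorm u * enorm v.
Proof.
have [u0|u0] := eqVneq (enorm u) 0.
  rewrite u0 mul0r (enorm_eq0 u0) /dot big1// => i _.
  by rewrite mxE mul0r.
have [v0|v0] := eqVneq (enorm v) 0.
  rewrite v0 mulr0 (enorm_eq0 v0) /dot big1// => i _.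
  by rewrite mxE mulr0.
have ab0 : 0 < enorm u * enorm v.
  by rewrite mulr_gt0// lt_neqAle eq_sym ?u0 ?v0 enorm_ge0.
have : 0 <= \sum_i (enorm v * u 0 i - enorm u * v 0 i) ^+ 2.
  by apply: sumr_ge0 => i _; exact: sqr_ge0.
rewrite (_ : \sum_i _ = 2 * (enorm u * enorm v) *
                        (enorm u * enorm v - dot u v)); last first.
  transitivity (enorm v ^+ 2 * dot u u + enorm u ^+ 2 * dot v v
                - 2 * (enorm u * enorm v) * dot u v).
    rewrite /dot !mulr_sumr -!big_split/= -sumrB; apply: eq_bigr => i _; ring.
  rewrite -!sqr_enorm; ring.
have c0 : 0 < 2 * (enorm u * enorm v) by rewrite mulr_gt0.
by rewrite (pmulr_rge0 _ c0) subr_ge0.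
Qed.

Lemma enormD m (u v : 'rV[R]_m) : enorm (u + v) <= enorm u + enorm v.
Proof.
rewrite -(@ler_pXn2r _ 2)// ?nnegrE ?addr_ge0 ?enorm_ge0// sqr_enorm sqrrD.
rewrite !sqr_enorm (_ : dot _ _ = dot u u + dot u v *+ 2 + dot v v).
  by rewrite lerD2r lerD2l lerMn2r/= dot_le.
rewrite /dot -sumrMnl -!big_split/=; apply: eq_bigr => i _; rewrite mxE; ring.
Qed.

Lemma le_norm_enorm m (u : 'rV[R]_m) : `|u| <= enorm u.
Proof.
rewrite /Num.norm/= mx_normrE; apply: bigmax_le => [|[i j] _ /=].
  exact: enorm_ge0.
by rewrite ord1 le_coord_enorm.
Qed.

Lemma le_coord_norm m (u : 'rV[R]_m) i : `|u 0 i| <= `|u|.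
Proof.
rewrite {2}/Num.norm/= mx_normrE.
exact: (le_bigmax_cond _ (fun ij : 'I_1 * 'I_m => `|u ij.1 ij.2|) (j := (0, i))).
Qed.

Lemma enorm_sum m (I : Type) (r : seq I) (F : I -> 'rV[R]_m) :
  enorm (\sum_(i <- r) F i) <= \sum_(i <- r) enorm (F i).
Proof.
elim: r => [|i r ih]; first by rewrite !big_nil enorm0.
by rewrite !big_cons; apply: (le_trans (enormD _ _)); rewrite lerD2l.
Qed.

Lemma linear_enorm_bounded m n (L : {linear 'rV[R]_m -> 'rV[R]_n}) :
  exists2 C, 0 < C & forall u, enorm (L u) <= C * enorm u.
Proof.
exists (1 + \sum_i enorm (L (delta_mx 0 i))).
  by apply: ltr_pwDl => //; apply: sumr_ge0 => i _; exact: enorm_ge0.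
move=> u; rewrite {1}(row_sum_delta u) linear_sum.
apply: (le_trans (enorm_sum _ _)).
rewrite mulrDl mul1r mulr_suml; apply: ler_wpDl; first exact: enorm_ge0.
apply: ler_sum => i _; rewrite linearZ enormZ mulrC.
by apply: ler_wpM2l; rewrite ?enorm_ge0// le_coord_enorm.
Qed.

Lemma enorm_le_norm m : exists2 C, 0 < C &
  forall u : 'rV[R]_m, enorm u <= C * `|u|.
Proof.
exists (1 + \sum_i enorm (delta_mx 0 i : 'rV[R]_m)).
  by apply: ltr_pwDl => //; apply: sumr_ge0 => i _; exact: enorm_ge0.
move=> u; rewrite {1}(row_sum_delta u).
apply: (le_trans (enorm_sum _ _)).
rewrite mulrDl mul1r mulr_suml; apply: ler_wpDl => //.
apply: ler_sum => i _; rewrite enormZ mulrC.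
by apply: ler_wpM2l; rewrite ?enorm_ge0// le_coord_norm.
Qed.

Lemma continuous_dot m (u : 'rV[R]_m) : continuous (dot u).
Proof.
apply: continuous_big => [|i _ v]; first exact: add_continuous.
by apply: (@cvgMl_tmp _ _ (nbhs v) _ (fun x : 'rV[R]_m => x 0 i));
  exact: coord_continuous.
Qed.

Lemma continuous_enorm m : continuous (@enorm m).
Proof.
move=> v; apply: continuous_comp; last exact: sqrt_continuous.
apply: continuous_big => [|i _ w]; first exact: add_continuous.
by apply: (@cvgM _ _ (nbhs w) _ (fun x : 'rV[R]_m => x 0 i) (fun x => x 0 i));
  exact: coord_continuous.
Qed.

Lemma dot_linear m (u : 'rV[R]_m) : linear (dot u : 'rV[R]_m -> R^o).
Proof.
move=> a v w; rewrite /dot scaler_sumr -big_split; apply: eq_bigr => i _.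
by rewrite !mxE /GRing.scale/=; ring.
Qed.

HB.instance Definition _ m (u : 'rV[R]_m) :=
  GRing.isLinear.Build R 'rV[R]_m R^o *:%R (dot u) (@dot_linear m u).

Lemma linear_rV_continuous m n (L : {linear 'rV[R]_m -> 'rV[R]_n}) :
  continuous L.
Proof.
have [C C0 HC] := linear_enorm_bounded L.
have [D D0 HD] := enorm_le_norm m.
apply/bounded_linear_continuous/linear_boundedP.
exists (C * D); split; first exact: num_real.
move=> r Mr x; apply: (le_trans (le_norm_enorm _)); apply: (le_trans (HC _)).
apply: (@le_trans _ _ (C * D * `|x|)); first by rewrite -mulrA ler_pM2l.
by apply: ler_wpM2r => //; exact: ltW.
Qed.

Lemma nbhs_enorm m (y : 'rV[R]_m) (A : set 'rV[R]_m) : nbhs y A ->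
  exists2 e, 0 < e & forall z, enorm (z - y) < e -> A z.
Proof.
move=> /nbhs_ballP[e /= e0 eA]; exists e => // z ze; apply: eA.
rewrite -ball_normE /= distrC; exact: le_lt_trans (le_norm_enorm _) ze.
Qed.

Lemma enorm_nbhs m (y : 'rV[R]_m) (e : R) : 0 < e ->
  \forall z \near y, enorm (z - y) < e.
Proof.
move=> e0.
have [C C0 HC] := enorm_le_norm m.
apply/nbhs_ballP; exists (e / C) => /=; first by rewrite divr_gt0.
move=> z; rewrite -ball_normE /= distrC ltr_pdivlMr// mulrC => ze.
exact: le_lt_trans (HC _) ze.
Qed.

Lemma compact_closure_enorm m (A : set 'rV[R]_m) (r : R) :
  (forall z, A z -> enorm z <= r) -> compact (closure A).
Proof.
move=> Ar; apply: bounded_closed_compact; last exact: closed_closure.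
exists r; split; first exact: num_real.
move=> s rs z Az; apply/ltW; apply: le_lt_trans rs.
have cl : closed [set z : 'rV[R]_m | `|z| <= r].
  rewrite (_ : [set _ | _] = (fun z : 'rV[R]_m => `|z|) @^-1` [set x | x <= r])//.
  by apply: preimage_closed => [? _|]; [exact: norm_continuous|exact: closed_le].
have AB : A `<=` [set z | `|z| <= r].
  by move=> y Ay; exact: le_trans (le_norm_enorm _) (Ar _ Ay).
change ([set z : 'rV[R]_m | `|z| <= r] z).
by move/closure_id: cl => ->; exact: (closureS AB).
Qed.

Lemma compact_closure_bounded m (A : set 'rV[R]_m) :
  compact (closure A) -> exists2 r, 0 < r & forall z, A z -> enorm z <= r.
Proof.
move=> /compact_bounded[M [Mr MA]].
have [C C0 HC] := enorm_le_norm m.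
exists (C * (`|M| + 1)); first by rewrite mulr_gt0// ltr_pwDr.
move=> z Az; apply: (le_trans (HC z)); rewrite ler_pM2l//.
apply: (MA (`|M| + 1)); first by rewrite ltr_pwDr// real_ler_norm.
exact: subset_closure.
Qed.

End EuclideanNorm.

(** * Cholesky factorization *)

(** Induction on the size: the Schur complement of the upper left entry is
    again positive definite, since it is the restriction of the quadratic form
    to the vectors (- v b^T / g, v) that are orthogonal to the first basis
    vector. *)
Lemma cholesky (R : realType) n (G : 'M[R]_n) :
  G^T = G -> (forall u : 'rV_n, u != 0 -> 0 < (u *m G *m u^T) 0 0) ->
  exists2 A, A \in unitmx & G = A *m A^T.
Proof.
elim: n G => [|n ih] G symG posG.
  by exists 1%:M; [exact: unitmx1|rewrite [LHS]flatmx0 [RHS]flatmx0].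
move: G symG posG; rewrite -[n.+1]/(1 + n)%N => G symG posG.
pose a := ulsubmx G; pose b := ursubmx G; pose D := drsubmx G.
pose g : R := a 0 0.
have aE : a = g%:M by rewrite [LHS]mx11_scalar.
have bE : dlsubmx G = b^T by rewrite /b trmx_ursub symG.
have DE : D^T = D by rewrite /D trmx_drsub symG.
have GE : G = block_mx g%:M b b^T D by rewrite -[LHS]submxK -aE bE.
have g0 : 0 < g.
  have := posG (row_mx 1 0).
  rewrite GE mul_row_block !mul0mx !addr0 tr_row_mx mul_row_col trmx0 mulmx0.
  rewrite addr0 mul1mx trmx1 mulmx1 mxE eqxx; apply.
  apply/eqP => /(congr1 lsubmx); rewrite row_mxKl => /matrixP /(_ 0 0).
  by rewrite !mxE; apply/eqP; rewrite oner_eq0.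
have [A' A'u A'E] : exists2 A, A \in unitmx & D - g^-1 *: (b^T *m b) = A *m A^T.
  apply: ih.
    by rewrite linearB linearZ/= trmx_mul trmxK DE.
  move=> v v0; pose t := - (g^-1 *: (v *m b^T)).
  have := posG (row_mx t v).
  rewrite GE mul_row_block tr_row_mx mul_row_col mul_mx_scalar.
  have -> : g *: t + v *m b^T = 0.
    by rewrite /t scalerN scalerA divff ?gt_eqF// scale1r addNr.
  have -> : t *m b + v *m D = v *m (D - g^-1 *: (b^T *m b)).
    by rewrite mulmxBr -scalemxAr mulmxA /t mulNmx scalemxAl addrC.
  rewrite mul0mx add0r; apply.
  apply/eqP => /(congr1 rsubmx); rewrite row_mxKr linear0 => /eqP.
  exact/negP.
pose s := Num.sqrt g.
have s0 : 0 < s by rewrite sqrtr_gt0.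
exists (block_mx s%:M 0 (s^-1 *: b^T) A').
  rewrite unitmxE det_lblock det_scalar1 unitrM -unitmxE A'u andbT.
  by rewrite unitfE gt_eqF.
rewrite tr_block_mx mulmx_block trmx0 !mul0mx !mulmx0 !addr0 -A'E.
rewrite tr_scalar_mx -scalar_mxM -expr2 sqr_sqrtr ?ltW//.
rewrite mul_scalar_mx mul_mx_scalar linearZ/= trmxK !scalerA divff ?gt_eqF//.
rewrite !scale1r -scalemxAl -scalemxAr scalerA -invfM -expr2 sqr_sqrtr ?ltW//.
by rewrite addrC subrK.
Qed.

(** * Weak convergence of asymptotically equivalent set functions *)

Section RatioLimits.
Context {R : realType}.
Local Open Scope ereal_scope.

(** Multiplicative form of b / a --> 1, which also makes sense for the values 0
    and infinity. *)
Definition asymp_equiv (a b : R -> \bar R) : Prop :=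
  forall e : R, (0 < e)%R -> \forall r \near 0%R^'+,
    b r <= (1 + e)%:E * a r /\ a r <= (1 + e)%:E * b r.

Lemma asymp_equiv_cvg (a b : R -> \bar R) (l : \bar R) :
  (forall r, 0 <= a r) -> (forall r, 0 <= b r) -> asymp_equiv a b ->
  a r @[r --> 0%R^'+] --> l -> b r @[r --> 0%R^'+] --> l.
Proof.
move=> a0 b0 ab; case: l => [l| |] al.
- have l0 : (0 <= l)%R.
    rewrite -lee_fin -(cvg_lim _ al)//; apply: lime_ge; last exact: nearW.
    by apply/cvg_ex; exists l%:E.
  move/fine_cvgP: al => [afin al].
  apply/fine_cvgP; split.
    have := ab 1%R ltr01; apply: filterS2 afin => r ar [br _].
    rewrite ge0_fin_numE//; apply: le_lt_trans br _.
    by rewrite -ge0_fin_numE ?mule_ge0// fin_numM.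
  apply/cvgrPdist_le => /= d d0.
  (* |b r - l| is at most e (2 l + 3) when |a r - l| <= e <= 1. *)
  pose e := (Num.min 1 (d / (2 * (l + 2))))%R.
  have l2 : (0 < 2 * (l + 2))%R by lra.
  have e0 : (0 < e)%R by rewrite lt_min ltr01 divr_gt0.
  have e1 : (e <= 1)%R by rewrite ge_min lexx.
  have ed : (e * (2 * (l + 2)) <= d)%R by rewrite -ler_pdivlMr// ge_min lexx orbT.
  move/cvgrPdist_le/(_ e e0): al => al.
  have := ab e e0; apply: filterS3 al afin => r /= alr ar [br arb].
  have bfin : b r \is a fin_num.
    rewrite ge0_fin_numE//; apply: le_lt_trans br _.
    by rewrite -ge0_fin_numE ?mule_ge0// ?fin_numM// lee_fin; lra.
  move: br arb alr (a0 r) (b0 r).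
  rewrite -(fineK ar) -(fineK bfin) -!EFinM !lee_fin/=.
  set A := fine (a r); set B := fine (b r) => h1 h2.
  rewrite !ler_norml => /andP[h3 h4] A0 B0.
  have B1 : (B <= (1 + e) * (l + e))%R.
    by apply: (le_trans h1); rewrite ler_pM2l; lra.
  have eB : (e * B <= e * (2 * (l + 1)))%R.
    rewrite ler_pM2l//; apply: (le_trans B1).
    by apply: ler_pM; lra.
  by apply/andP; split; nra.
- apply/cvgeyPge => A; have /cvgeyPge/(_ (2 * A)%R) := al.
  have := ab 1%R ltr01; apply: filterS2 => r [_ ar] Ar.
  have : (2 * A)%:E <= 2%:E * b r.
    by apply: (le_trans Ar); rewrite -[2%R]/(1 + 1)%R.
  by rewrite EFinM lee_pmul2l.
- have /cvgeNyPle/(_ (-1)%R) al1 := al.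
  exfalso; near ((0 : R)%R^'+) => r.
  have : a r <= (-1)%:E by near: r.
  move=> /(le_trans (a0 r)); rewrite leNgt => /negP; apply.
  by rewrite lte_fin ltrN10.
Unshelve. all: by end_near. Qed.

(** The difference may be of the form +oo - +oo = -oo; then both orders of the
    difference of the a's tend to -oo, which forces the a's, hence the b's, to be
    infinite. *)
Lemma asymp_equiv_cvgB (a a' b b' : R -> \bar R) (l l' : \bar R) :
  (forall r, 0 <= a r) -> (forall r, 0 <= b r) -> asymp_equiv a b ->
  (forall r, 0 <= a' r) -> (forall r, 0 <= b' r) -> asymp_equiv a' b' ->
  a r @[r --> 0%R^'+] --> l -> a' r @[r --> 0%R^'+] --> l' ->
  a r - a' r @[r --> 0%R^'+] --> l - l' ->
  a' r - a r @[r --> 0%R^'+] --> l' - l ->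
  b r - b' r @[r --> 0%R^'+] --> l - l'.
Proof.
move=> a0 b0 ab a'0 b'0 a'b' al a'l' aa' a'a.
have bl := asymp_equiv_cvg a0 b0 ab al.
have b'l' := asymp_equiv_cvg a'0 b'0 a'b' a'l'.
have ge0_lim (u : R -> \bar R) v : (forall r, 0 <= u r) ->
    u r @[r --> 0%R^'+] --> v -> 0 <= v.
  move=> u0 uv; rewrite -(cvg_lim _ uv)//.
  by apply: lime_ge; [apply/cvg_ex; exists v|exact: nearW].
have l0 := ge0_lim _ _ a0 al; have l'0 := ge0_lim _ _ a'0 a'l'.
have [ll'|] := boolP (l +? - l'); first exact: cvgeB.
rewrite /adde_def negb_and !negbK.
move=> /orP[/andP[/eqP ly]|/andP[/eqP ly]]; last first.
  by move: l0; rewrite ly.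
rewrite eqe_oppLR/= => /eqP l'y.
move: aa' a'a; rewrite {}ly {}l'y /= => /cvgeNyPle/(_ (-1)%R) h1.
move=> /cvgeNyPle/(_ (-1)%R) h2.
have oo r : a r - a' r <= (-1)%:E -> a' r - a r <= (-1)%:E ->
    a r = +oo /\ a' r = +oo.
  move: (a0 r) (a'0 r); case: (a r) => [x| |]; case: (a' r) => [y| |]//=.
  by rewrite !lee_fin => _ _ h3 h4; exfalso; clear -h3 h4; lra.
apply: cvg_near_cst.
have hab := ab 1%R ltr01; have ha'b' := a'b' 1%R ltr01.
near=> r.
have [ar a'r] : a r = +oo /\ a' r = +oo by apply: oo; near: r.
have byy (x : \bar R) : 0 <= x -> +oo <= (1 + 1)%:E * x -> x = +oo.
  by case: x => //= x _; rewrite -EFinM leye_eq.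
have -> : b r = +oo.
  apply: byy (b0 r) _; rewrite -[X in X <= _]ar.
  by have [] : b r <= (1 + 1)%:E * a r /\ a r <= (1 + 1)%:E * b r by near: r.
have -> // : b' r = +oo.
apply: byy (b'0 r) _; rewrite -[X in X <= _]a'r.
by have [] : b' r <= (1 + 1)%:E * a' r /\ a' r <= (1 + 1)%:E * b' r by near: r.
Unshelve. all: by end_near. Qed.

End RatioLimits.

Section TestFunctions.
Context {R : realType} {m : nat}.
Local Open Scope ereal_scope.
Local Notation V := 'rV[R]_m.
Local Notation borel := (@borel_rV R m).
Implicit Types (f : V -> R) (mu nu : set V -> \bar R).

Lemma borel_open (A : set V) : open A -> measurable (A : set borel).
Proof. by move=> oA; exact: sub_sigma_algebra. Qed.

Lemma borel_preimage (D : set V) (L : V -> V) (B : set V) :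
  open D -> (forall w, D w -> {for w, continuous L}) ->
  measurable (B : set borel) ->
  measurable (D `&` L @^-1` B : set borel).
Proof.
move=> oD cL mB.
have : <<s [set A : set V | open A] >> `<=`
    [set A | measurable (D `&` L @^-1` A : set borel)].
  apply: smallest_sub; last first.
    move=> A /= oA; apply: borel_open; rewrite openE => w [Dw LAw].
    apply: filterI; first exact: open_nbhs_nbhs.
    by apply: (cL w Dw); exact: open_nbhs_nbhs.
  split => /=.
  - by rewrite preimage_set0 setI0; exact: measurable0.
  - move=> A mA; rewrite setTD.
    rewrite (_ : _ `&` _ = (D : set borel) `\` (D `&` L @^-1` A)).
      by apply: measurableD => //; exact: borel_open.
    apply/seteqP; split=> w /= [Dw nA]; split=> //; first by case.
    by move=> Aw; apply: nA.
  - move=> F mF; rewrite preimage_bigcup setI_bigcupr.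
    exact: bigcup_measurable.
exact.
Qed.

(** The properties of a measure that the supremum over simple functions needs
    in order to be nonnegative and to ignore empty level sets. *)
Definition nonneg_set_function mu := mu set0 = 0 /\ forall B, 0 <= mu B.

Definition posint mu f : \bar R :=
  nnint (T := borel) mu (fun z : borel => (Num.max (f z) 0)%:E).

Lemma integral_rVE mu f :
  integral_rV mu f = posint mu f - posint mu (fun z => - f z)%R.
Proof.
rewrite /integral_rV integral_nnint /posint; congr (_ - _); congr (nnint _ _).
  by apply/funext => z; rewrite funeposE/= EFin_max.
by apply/funext => z; rewrite funenegE/= EFin_max.
Qed.

Lemma posint_ge0 mu f : mu set0 = 0 -> 0 <= posint mu f.
Proof.
by move=> mu0; apply: nnint_ge0 => // z; rewrite lee_fin le_max lexx orbT.
Qed.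

Lemma posint_transfer nu mu (L : V -> V) (D : set V) (C : R) f f' :
  (0 <= C)%R -> nonneg_set_function nu -> nonneg_set_function mu -> open D ->
  (forall w, D w -> {for w, continuous L}) ->
  (forall B, B `<=` [set z | 0 < f z]%R ->
     nu B <= C%:E * mu (D `&` L @^-1` B)) ->
  (forall w, D w -> f (L w) <= f' w)%R ->
  posint nu f <= C%:E * posint mu f'.
Proof.
move=> C0 [nu0 nuge0] [mu0 muge0] oD cL numu ff'.
apply: (@nnint_transfer _ _ borel _ borel _ _ L D) => //.
- by move=> w; rewrite lee_fin le_max lexx orbT.
- exact: borel_open.
- by move=> B; exact: borel_preimage.
- move=> B _ Bf; apply: numu => z /Bf /=.
  by rewrite lte_fin lt_max ltxx orbF.
- by move=> w Dw; rewrite lee_fin ge_max le_max ff'// le_max lexx orbT.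
Qed.

Lemma posint_le nu mu (C : R) f :
  (0 <= C)%R -> nonneg_set_function nu -> nonneg_set_function mu ->
  (forall B, B `<=` [set z | 0 < f z]%R -> nu B <= C%:E * mu B) ->
  posint nu f <= C%:E * posint mu f.
Proof.
move=> C0 hnu hmu numu.
apply: (@posint_transfer _ _ id setT) => //.
- exact: openT.
- by move=> w _; exact: cvg_id.
- by move=> B Bf; rewrite setTI preimage_id; exact: numu.
Qed.

Lemma posint_null nu f : nonneg_set_function nu ->
  (forall B, B `<=` [set z | 0 < f z]%R -> nu B = 0) -> posint nu f = 0.
Proof.
move=> hnu nu0; apply/eqP; rewrite eq_le posint_ge0 ?andbT; last by case: hnu.
rewrite -(mul0e (posint nu f)); apply: posint_le => // B Bf; rewrite nu0//.
by rewrite mul0e.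
Qed.

(** Boundedness of the set where f does not vanish is stable under linear
    changes of variable without any topological argument. *)
Definition test_function f : Prop := continuous f /\
  exists2 r : R, (0 < r)%R & forall z, (f z != 0)%R -> (enorm z <= r)%R.

Lemma test_functionN f : test_function f -> test_function (fun z => - f z)%R.
Proof.
move=> [cf [r r0 fr]]; split.
  by move=> z; apply: continuousN; exact: cf.
by exists r => // z; rewrite oppr_eq0; exact: fr.
Qed.

Lemma test_function_max0 f : test_function f ->
  test_function (fun z => Num.max (f z) 0)%R.
Proof.
move=> [cf [r r0 fr]]; split.
  move=> z; apply: (@continuous_max _ _ f (cst 0%R)); first exact: cf.
  exact: cst_continuous.
exists r => // z zf; apply: fr; apply: contra zf => /eqP ->.
by rewrite maxxx.
Qed.

Lemma weak_star_cvg_test (mu : R -> set V -> \bar R) nu :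
  weak_star_cvg mu nu <-> forall f, test_function f ->
    integral_rV (mu r) f @[r --> 0%R^'+] --> integral_rV nu f.
Proof.
split=> h f.
  move=> [cf [r r0 fr]]; apply: h => //.
  exact: compact_closure_enorm fr.
move=> cf /compact_closure_bounded fr; apply: h; split=> //.
Qed.

Lemma integral_rV_ge0 mu f : nonneg_set_function mu -> (forall z, 0 <= f z)%R ->
  integral_rV mu f = posint mu f.
Proof.
move=> hmu f0; rewrite integral_rVE [X in _ - X]posint_null ?sube0// => B Bf.
rewrite (_ : B = set0); first by case: hmu.
by rewrite -subset0 => z /Bf /=; rewrite oppr_gt0 ltNge f0.
Qed.

Lemma posint_max0 mu f : posint mu (fun z => Num.max (f z) 0)%R = posint mu f.
Proof.
congr nnint; apply/funext => z; congr EFin.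
by rewrite (max_l (x := Num.max (f z) 0)%R)// le_max lexx orbT.
Qed.

(** B is quantified after r: the comparison passes to integrals because it is
    uniform in the level sets of simple functions. *)
Definition locally_asymp_equiv (mu mu' : R -> set V -> \bar R) : Prop :=
  forall rho e : R, (0 < rho)%R -> (0 < e)%R -> \forall r \near 0%R^'+,
    forall B, B `<=` [set z | enorm z <= rho]%R ->
      mu' r B <= (1 + e)%:E * mu r B /\ mu r B <= (1 + e)%:E * mu' r B.

Lemma locally_asymp_equiv_posint (mu mu' : R -> set V -> \bar R) f :
  (forall r, nonneg_set_function (mu r)) ->
  (forall r, nonneg_set_function (mu' r)) ->
  locally_asymp_equiv mu mu' -> test_function f ->
  asymp_equiv (fun r => posint (mu r) f) (fun r => posint (mu' r) f).
Proof.
move=> hmu hmu' equ [cf [rho rho0 frho]] e e0.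
have := equ rho e rho0 e0; apply: filterS => r h.
have sub (B : set V) : B `<=` [set z | 0 < f z]%R ->
    B `<=` [set z | enorm z <= rho]%R.
  by move=> Bf z /Bf /= z0; apply: frho; rewrite gt_eqF.
have e1 : (0 <= 1 + e)%R by lra.
by split; apply: posint_le => // B /sub /h[].
Qed.

(** The integrals of f and of - f, and of their positive parts, converge for
    mu; the latter have the same limits for mu', and the former are recovered
    by difference. *)
Lemma weak_star_cvg_asymp_equiv (mu mu' : R -> set V -> \bar R) nu :
  (forall r, nonneg_set_function (mu r)) ->
  (forall r, nonneg_set_function (mu' r)) ->
  nonneg_set_function nu ->
  locally_asymp_equiv mu mu' -> weak_star_cvg mu nu -> weak_star_cvg mu' nu.
Proof.
move=> hmu hmu' hnu equ /weak_star_cvg_test munu; apply/weak_star_cvg_test.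
move=> f tf; have tNf := test_functionN tf.
rewrite integral_rVE; under eq_cvg do rewrite integral_rVE.
have poscvg g : test_function g ->
    posint (mu r) g @[r --> 0%R^'+] --> posint nu g.
  move=> tg; have := munu _ (test_function_max0 tg).
  rewrite integral_rV_ge0//; last by move=> z; rewrite le_max lexx orbT.
  rewrite posint_max0; under eq_cvg.
    move=> r; rewrite integral_rV_ge0//; last first.
      by move=> z; rewrite le_max lexx orbT.
    rewrite posint_max0; over.
  by [].
have posge0 (la : R -> set V -> \bar R) g :
    (forall r, nonneg_set_function (la r)) -> forall r, 0 <= posint (la r) g.
  by move=> hla r; apply: posint_ge0; case: (hla r).
apply: (@asymp_equiv_cvgB _ (fun r => posint (mu r) f)
    (fun r => posint (mu r) (fun z => - f z)%R)).
- exact: posge0.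
- exact: posge0.
- exact: locally_asymp_equiv_posint.
- exact: posge0.
- exact: posge0.
- exact: locally_asymp_equiv_posint.
- exact: poscvg.
- exact: poscvg.
- have := munu f tf; rewrite integral_rVE.
  by under eq_cvg do rewrite integral_rVE.
- have := munu _ tNf; rewrite integral_rVE.
  under eq_cvg do rewrite integral_rVE.
  by rewrite (_ : (fun z => - - f z)%R = f)//; apply/funext => z; rewrite opprK.
Qed.

Lemma posint_bij mu mu' (L L' : V -> V) f :
  nonneg_set_function mu -> nonneg_set_function mu' ->
  continuous L -> continuous L' -> cancel L L' -> cancel L' L ->
  (forall B, mu' B = mu (L @^-1` B)) ->
  posint mu' f = posint mu (f \o L).
Proof.
move=> hmu hmu' cL cL' LK L'K mumu'; apply/eqP; rewrite eq_le; apply/andP; split.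
  rewrite -[leRHS]mul1e; apply: (@posint_transfer _ _ L setT) => //.
  - exact: openT.
  - by move=> w _; exact: cL.
  - by move=> B _; rewrite mul1e setTI mumu'.
rewrite -[leRHS]mul1e; apply: (@posint_transfer _ _ L' setT) => //.
- exact: openT.
- by move=> w _; exact: cL'.
- move=> B _; rewrite mul1e setTI mumu' -comp_preimage.
  by rewrite (_ : L' \o L = id) ?preimage_id//; apply/funext.
- by move=> w _ /=; rewrite L'K.
Qed.

Lemma weak_star_cvg_linear (L L' : {linear V -> V})
    (mu mu' : R -> set V -> \bar R) nu nu' :
  (forall r, nonneg_set_function (mu r)) ->
  (forall r, nonneg_set_function (mu' r)) ->
  nonneg_set_function nu -> nonneg_set_function nu' ->
  cancel L L' -> cancel L' L ->
  (forall r B, mu' r B = mu r (L @^-1` B)) ->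
  (forall B, nu' B = nu (L @^-1` B)) ->
  weak_star_cvg mu nu -> weak_star_cvg mu' nu'.
Proof.
move=> hmu hmu' hnu hnu' LK L'K mumu' nunu' /weak_star_cvg_test munu.
have cL : continuous L := @linear_rV_continuous _ _ _ L.
have cL' : continuous L' := @linear_rV_continuous _ _ _ L'.
apply/weak_star_cvg_test => f [cf [r r0 fr]].
have E (la la' : set V -> \bar R) :
    nonneg_set_function la -> nonneg_set_function la' ->
    (forall B, la' B = la (L @^-1` B)) ->
    integral_rV la' f = integral_rV la (f \o L).
  by move=> h h' lala'; rewrite !integral_rVE !(posint_bij _ h h' cL cL').
rewrite (E nu nu')//.
have -> : (fun r => integral_rV (mu' r) f) =
    fun r => integral_rV (mu r) (f \o L).
  by apply/funext => s; exact: E.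
apply: munu; split.
  by move=> z; apply: continuous_comp; [exact: cL|exact: cf].
have [C C0 HC] := linear_enorm_bounded L'.
exists (C * r)%R; first by rewrite mulr_gt0.
move=> z /fr zr; rewrite -(LK z); apply: (le_trans (HC _)).
by rewrite ler_pM2l.
Qed.

End TestFunctions.

Section SimpleLowerBound.
Context {R : realType} {m : nat}.
Import HBNNSimple.
Local Open Scope ereal_scope.

(** The function equal to c on B and to 0 elsewhere is a competitor. *)
Lemma posint_ge (mu : set 'rV[R]_m -> \bar R) (f : 'rV[R]_m -> R)
    (B : set 'rV[R]_m) (c : R) :
  nonneg_set_function mu -> open B -> (0 <= c)%R ->
  (forall z, B z -> c <= f z)%R ->
  c%:E * mu B <= posint mu f.
Proof.
move=> [mu0 muge0] oB; rewrite le_eqVlt => /predU1P[<- _|c0 cf].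
  by rewrite mul0e; exact: posint_ge0.
pose borel := @borel_rV R m.
pose h (z : borel) : R := if z \in B then c else 0%R.
have fimh : finite_set (range h).
  apply: (@sub_finite_set _ _ [set c; 0%R]); last by rewrite finite_setU.
  by move=> _ [w _ <-]; rewrite /h; case: ifP => _; [left|right].
have mh : measurable_fun setT h.
  have E : h = ((cst c : borel -> R) \_ B) by apply/funext => w; rewrite patchE.
  by rewrite E; apply/(measurable_restrictT _ (borel_open oB)).
have h0 w : (0 <= h w)%R by rewrite /h; case: ifP => // _; exact: ltW.
pose M1 := @isMeasurableFun.Build _ _ _ _ h mh.
pose M2 := @FiniteImage.Build _ _ h fimh.
pose M3 := @isNonNegFun.Build _ _ h h0.
pose hn : {nnsfun borel >-> R} := HB.pack h M1 M2 M3.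
have -> : c%:E * mu B = sintegral mu hn.
  rewrite /sintegral -(fsbig_widen [set c] setT)//=; last first.
    move=> x [_ /= /eqP xc]; have [->|x0] := eqVneq x 0%R; first by rewrite mul0e.
    rewrite (_ : h @^-1` _ = set0) ?mu0 ?mule0// -subset0 => w /=.
    by rewrite /h; case: ifP => _ hx; move: xc x0; rewrite -hx eqxx.
  rewrite fsbig_set1; congr (_ * mu _); apply/seteqP; split=> w /=; rewrite /h.
    by move=> Bw; rewrite mem_set.
  by case: ifPn => [|_ c00]; rewrite ?inE//; move: c0; rewrite -c00 ltxx.
apply: ereal_sup_ubound; exists hn => // w /=; rewrite /h lee_fin le_max.
by case: ifPn => [|_]; [rewrite inE => /cf ->|rewrite lexx orbT].
Qed.

End SimpleLowerBound.

(** * Curves in charts *)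

Section IntegralComparison.
Import HBNNSimple.

(** Read off the suprema that define the integrals, so that it applies to the
    speed of a curve, about which only pointwise bounds are known. *)
Lemma le_integral_nonneg d (T : measurableType d) (R : realType)
    (mu : {measure set T -> \bar R}) (D D' : set T) (f h : T -> \bar R) :
  D `<=` D' -> (forall x, D x -> h x <= f x)%E ->
  (forall x, D' x -> 0 <= f x)%E ->
  (integral mu D h <= integral mu D' f)%E.
Proof.
move=> DD' hf f0; rewrite (integralE mu D h) (integralE mu D' f).
apply: leeB; last first.
  rewrite (@integral0_eq _ _ _ mu D' (f^\-)%E); first exact: integral_ge0.
  by move=> x /f0 fx; rewrite funenegE max_r// oppe_le0.
rewrite !ge0_integralE//; apply: le_ereal_sup => _ [k /= hk <-].
exists k => //= x.
apply: (le_trans (hk x)); rewrite !patchE; case: ifPn => [|xD].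
  rewrite inE => xD; rewrite mem_set; last exact: DD'.
  by rewrite !funeposE ge_max !le_max hf//= lexx orbT.
by case: ifPn => // xD'; rewrite funeposE le_max lexx orbT.
Qed.

End IntegralComparison.

Section Coordinates.
Context {R : realType} {m : nat} {M : smoothManifold R m}.
Implicit Types (x : M) (phi psi chi : chart R m M).

Lemma tangent_coord_inj x phi (v w : tangent M x) :
  charts_at x phi -> v phi = w phi -> v = w.
Proof.
by move=> hphi vw; rewrite -(tangent_coordK v hphi) vw tangent_coordK.
Qed.

Lemma charts_at_image phi (y : 'rV[R]_m) :
  atlas phi -> (phi @` chart_dom phi) y -> charts_at (chart_inv phi y) phi.
Proof. by move=> aphi [z dz <-]; split=> //; rewrite chart_mapK. Qed.

Lemma chart_invK phi (y : 'rV[R]_m) :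
  (phi @` chart_dom phi) y -> phi (chart_inv phi y) = y.
Proof. by move=> [z dz <-]; rewrite chart_mapK. Qed.

(** The velocity is defined in a chosen chart around c s; the chain rule for
    the transition map gives its coordinates in the others. *)
Lemma velocity_coord (c : R -> M) (s : R) phi :
  charts_at (c s) phi -> {for s, continuous c} ->
  (forall psi, charts_at (c s) psi -> derivable (psi \o c) s 1) ->
  velocity c s phi = derive1 (phi \o c) s.
Proof.
move=> hphi cc dc; pose chi := chart_around (c s).
have hchi : charts_at (c s) chi := chart_aroundP (c s).
rewrite /velocity /= /vec_of_coord_fun asboolT//.
have dchi := dc _ hchi.
rewrite -/chi !derive1E.
have diffchi : differentiable (chi \o c) s by apply/derivable1_diffP.
have difft := transition_differentiable hchi hphi.
have -> : 'D_1 (phi \o c) s = 'D_1 (transition chi phi \o (chi \o c)) s.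
  apply: near_eq_derive.
  have : nbhs (c s) (chart_dom chi).
    by apply: open_nbhs_nbhs; split; [exact: chart_dom_open|case: hchi].
  move=> /cc; rewrite nbhs_simpl/=; apply: filterS => r hr.
  by rewrite /transition /= chart_mapK.
rewrite deriveE// deriveE; last exact: differentiable_comp.
exact: esym (congr1 (fun h => h 1) (diff_comp diffchi difft)).
Qed.

Lemma overlap_diff phi chi y : atlas phi -> atlas chi -> overlap phi chi y ->
  differentiable (transition phi chi) y /\
  forall v, {for y, continuous (fun z => 'D_v (transition phi chi) z)}.
Proof.
move=> aphi achi oy; have [/(_ 1%N)[d1 d2] _] := atlas_compatible aphi achi.
by split=> [|v]; [exact: d1|exact: d2].
Qed.

Lemma near_eq_continuous (T U : topologicalType) (f h : T -> U) (s : T) :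
  (\forall r \near s, f r = h r) -> {for s, continuous h} ->
  {for s, continuous f}.
Proof.
move=> fh ch A; rewrite /= (nbhs_singleton fh) => /ch; rewrite nbhs_simpl/=.
by apply: filterS2 fh => r /= ->.
Qed.

Lemma is_diff_line (y v : 'rV[R]_m) (s : R) :
  is_diff s (fun s => y + s *: v) ( *:%R ^~ v).
Proof.
have := is_diffD (is_diff_cst y s) (is_diff_scalel s v).
by rewrite add0r.
Qed.

Section Line.
Variables (phi : chart R m M) (aphi : atlas phi) (y v : 'rV[R]_m).
Let c s := chart_inv phi (y + s *: v).

(** Read in the chart chi, the coordinate segment of phi is the composition of
    the transition map with an affine map, hence is continuously
    differentiable. *)
Lemma line_derive_chart chi s : charts_at (c s) chi ->
  (phi @` chart_dom phi) (y + s *: v) ->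
  [/\ derivable (chi \o c) s 1,
      derive1 (chi \o c) s = 'D_v (transition phi chi) (y + s *: v) &
      {for s, continuous (derive1 (chi \o c))} ].
Proof.
move=> [achi dchi] imy.
pose l (s : R) := y + s *: v.
have dl r : differentiable l r by have [] := is_diff_line y v r.
have cl r : {for r, continuous l} by exact: differentiable_continuous.
have near_ov : \forall r \near s, overlap phi chi (l r).
  have hphi : charts_at (c s) phi by exact: charts_at_image.
  have := near_overlap hphi (conj achi dchi); rewrite chart_invK// => h.
  have := cl s _ h; rewrite nbhs_simpl/=; apply: filterS => r [[z dz zE]].
  by rewrite -/(l r) -zE chart_mapK// => dz'; exists z.
have E r : overlap phi chi (l r) -> derivable (chi \o c) r 1 /\
    derive1 (chi \o c) r = 'D_v (transition phi chi) (l r).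
  move=> ov; have [dt _] := overlap_diff aphi achi ov.
  have dcomp : differentiable (transition phi chi \o l) r.
    exact: differentiable_comp.
  split; first exact/derivable1_diffP.
  rewrite derive1E deriveE//.
  apply: (etrans (congr1 (fun h => h 1) (diff_comp (dl r) dt))).
  rewrite deriveE//=; congr ('d _ _ _).
  by have [_ ->] := is_diff_line y v r; rewrite scale1r.
have [d1 d2] := E _ (nbhs_singleton near_ov).
split; [exact: d1|exact: d2|].
apply: (@near_eq_continuous _ _ _
  (fun r => 'D_v (transition phi chi) (l r))).
  by have := near_ov; apply: filterS => r /E[].
have [_ ct] := overlap_diff aphi achi (nbhs_singleton near_ov).
have := continuous_comp (cl s) (ct v); exact.
Qed.

End Line.

End Coordinates.

(** * The Riemannian distance in a chart *)

Section RiemannianDistance.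
Context {R : realType} {m : nat} {M : smoothManifold R m}.
Variable g : riemannianMetric M.
Implicit Types (phi : chart R m M) (o : 'rV[R]_m) (c : R -> M).

Lemma tangent_norm_ge0 (z : M) (v : tangent M z) : 0 <= tangent_norm g v.
Proof. exact: sqrtr_ge0. Qed.

Lemma path_length_ge0 c : (0 <= path_length g c)%E.
Proof. by apply: integral_ge0 => s _; rewrite lee_fin tangent_norm_ge0. Qed.

Lemma riemannian_dist_ge0 (p q : M) : (0 <= riemannian_dist g p q)%E.
Proof.
apply: le_ereal_inf_tmp => _ [s _ <-].
by apply: sume_ge0 => c _; exact: path_length_ge0.
Qed.

Definition metric_pinched phi o (delta a b : R) : Prop :=
  (forall y : 'rV[R]_m, enorm (y - o) < delta -> (phi @` chart_dom phi) y) /\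
  forall z, chart_dom phi z -> enorm (phi z - o) < delta ->
    forall v : tangent M z,
      a * enorm (v phi) <= tangent_norm g v <= b * enorm (v phi).

Lemma C1_path_velocity_coord c (s : R) phi : C1_path c -> 0 <= s <= 1 ->
  charts_at (c s) phi -> velocity c s phi = derive1 (phi \o c) s.
Proof.
move=> [e e0 hc] s01 hphi.
have [|cc dc] := hc s; first by lra.
by apply: velocity_coord => // psi /dc[].
Qed.

(** The coordinate segment from p to q is a competitor. It is parametrized on a
    neighbourhood of [0, 1], whose image stays in the ball of radius delta when
    its ends are in the ball of radius delta / 4. *)
Lemma riemannian_dist_le phi o delta a b (p q : M) : atlas phi ->
  metric_pinched phi o delta a b -> 0 <= b ->
  chart_dom phi p -> chart_dom phi q ->
  enorm (phi p - o) < delta / 4 -> enorm (phi q - o) < delta / 4 ->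
  (riemannian_dist g p q <= (b * enorm (phi p - phi q))%:E)%E.
Proof.
move=> aphi [ball_im pinch] b0 dp dq yp yq.
have d0 : 0 < delta by have := enorm_ge0 (phi p - o); lra.
pose y := phi p; pose v : 'rV[R]_m := phi q - phi p.
pose c (s : R) := chart_inv phi (y + s *: v).
(* The weights of the two ends are at most 3 / 2, and
   3 / 2 * (delta / 4 + delta / 4) < delta. *)
have near_line (s : R) : - (1 / 2) < s < 1 + 1 / 2 ->
    enorm (y + s *: v - o) < delta.
  move=> /andP[s1 s2].
  have -> : y + s *: v - o = (1 - s) *: (phi p - o) + s *: (phi q - o).
    by apply/rowP => i; rewrite !mxE; ring.
  apply: le_lt_trans (enormD _ _) _; rewrite !enormZ.
  have b1 : `|1 - s| <= 3 / 2 by rewrite ler_norml; lra.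
  have b2 : `|s| <= 3 / 2 by rewrite ler_norml; lra.
  have := ler_pM (normr_ge0 _) (enorm_ge0 _) b1 (ltW yp).
  have := ler_pM (normr_ge0 _) (enorm_ge0 _) b2 (ltW yq).
  lra.
have im_line (s : R) : - (1 / 2) < s < 1 + 1 / 2 ->
    (phi @` chart_dom phi) (y + s *: v).
  by move=> /near_line /ball_im.
have C1c : C1_path c.
  exists (1 / 2) => [|s s01]; first by lra.
  have ims := im_line s s01; split.
    apply: (@continuous_comp _ _ _ (fun s : R => y + s *: v) (chart_inv phi)).
      by apply: differentiable_continuous; have [] := is_diff_line y v s.
    exact: chart_inv_continuous.
  move=> chi hchi; have [d1 _ d2] := line_derive_chart aphi hchi ims.
  split; [exact: d1|exact: d2].
have velE (s : R) : 0 <= s <= 1 -> velocity c s phi = v.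
  move=> s01.
  have ims : (phi @` chart_dom phi) (y + s *: v) by apply: im_line; lra.
  have hphi : charts_at (c s) phi by exact: charts_at_image.
  rewrite (C1_path_velocity_coord C1c)//.
  have [_ -> _] := line_derive_chart aphi hphi ims.
  rewrite -[RHS](derive_id (y + s *: v)); apply: near_eq_derive.
  have := near_overlap hphi hphi; rewrite chart_invK//.
  by apply: filterS => z [zim _]; rewrite /transition /= chart_invK.
apply: (@le_trans _ _ (path_length g c)).
  apply: ereal_inf_lbound; exists [:: c]; last by rewrite big_seq1.
  split=> //; first by rewrite /c scale0r addr0 chart_mapK.
  by rewrite /= /c scale1r /y /v addrC subrK chart_mapK.
rewrite enormB -/v.
have intc : (\int[lebesgue_measure]_(s in `[0%R, 1%R]) cst (b * enorm v)%:E s =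
    (b * enorm v)%:E :> \bar R)%E.
  rewrite integral_cst//= lebesgue_measure_itv/= lte_fin ltr01.
  by rewrite -EFinB subr0 mule1.
rewrite -intc.
apply: le_integral_nonneg => // s /=; rewrite in_itv/= => s01; last first.
  by rewrite lee_fin mulr_ge0// enorm_ge0.
have ims : (phi @` chart_dom phi) (y + s *: v) by apply: im_line; lra.
have [_ dz] := charts_at_image aphi ims.
rewrite lee_fin -(velE s s01).
have [] := andP (pinch (c s) dz _ (velocity c s)) => //.
by rewrite chart_invK//; apply: near_line; lra.
Qed.

(** The speed dominates the derivative of the coordinates along the direction
    of their total increment, and the integral of this derivative is computed
    by the fundamental theorem of calculus. *)
Lemma path_length_ge_chart phi (a : R) c (t : R) : atlas phi -> 0 < a ->
  C1_path c -> 0 <= t <= 1 ->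
  (forall s, 0 <= s <= t -> chart_dom phi (c s) /\
     forall v : tangent M (c s), a * enorm (v phi) <= tangent_norm g v) ->
  ((a * enorm (phi (c t) - phi (c 0)))%:E <= path_length g c)%E.
Proof.
move=> aphi a0 C1c t01 hc.
pose u := phi (c t) - phi (c 0); pose w := enorm u.
have [w0|w0] := eqVneq w 0.
  by rewrite -/u -/w w0 mulr0 path_length_ge0.
have wpos : 0 < w by rewrite lt_neqAle eq_sym w0 enorm_ge0.
have t0 : 0 < t.
  rewrite lt_neqAle eq_sym; case/andP: t01 => -> _; rewrite andbT.
  by apply: contra w0 => /eqP t0; rewrite /w /u t0 subrr enorm0.
pose k := (a / w) *: u.
pose ga := phi \o c.
have charts (s : R) : 0 <= s <= t -> charts_at (c s) phi.
  by move=> /hc[].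
have [e e0 he] := C1c.
have gaP (s : R) : 0 <= s <= t -> [/\ derivable ga s 1, {for s, continuous ga} &
    {for s, continuous (derive1 ga)}].
  move=> st; have [|_ /(_ _ (charts s st))[d1 d2]] := he s; first by lra.
  have dga : differentiable ga s by apply/derivable1_diffP; exact: d1.
  split; [exact: d1| |exact: d2].
  exact: differentiable_continuous dga.
have dH (s : R) : 0 <= s <= t ->
    is_derive s (1 : R) (dot k \o ga : R -> R) (dot k (derive1 ga s)).
  move=> /gaP[/derivable1_diffP dga _ _].
  have dk : differentiable (dot k : 'rV[R]_m -> R) (ga s).
    exact/linear_differentiable/continuous_dot.
  apply: DeriveDef.
    exact/derivable1_diffP/differentiable_comp.
  rewrite deriveE; last exact: differentiable_comp.
  apply: (etrans (congr1 (fun h => h 1) (diff_comp dga dk))) => /=.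
  rewrite derive1E deriveE//.
  by have -> := diff_lin (ga s) (@continuous_dot _ _ k).
have cH (s : R) : 0 <= s <= t -> {for s, continuous (dot k \o ga : R -> R)}.
  move=> /gaP[_ cga _].
  exact: (continuous_comp cga (@continuous_dot _ _ k (ga s))).
have FTC : (\int[lebesgue_measure]_(s in `[0%R, t]) (dot k (derive1 ga s))%:E =
    (dot k (ga t))%:E - (dot k (ga 0))%:E)%E.
  apply: (@continuous_FTC2 R (fun s => dot k (derive1 ga s)) (dot k \o ga)) => //.
  - apply: continuous_in_subspaceT => s; rewrite inE/= in_itv/= => st.
    have [_ _ cga'] := gaP s st.
    exact: (continuous_comp cga' (@continuous_dot _ _ k (derive1 ga s))).
  - split.
    + move=> s; rewrite in_itv/= => /andP[s1 s2].
      by have [] := dH s _; first by rewrite !ltW.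
    + by apply/cvg_at_right_filter/cH; rewrite lexx ltW.
    + by apply/cvg_at_left_filter/cH; rewrite lexx ltW.
  - move=> s; rewrite in_itv/= => /andP[s1 s2].
    rewrite derive1E; have [] := dH s _; first by rewrite !ltW.
    by move=> _ ->.
have -> : (a * enorm u)%:E = ((dot k (ga t))%:E - (dot k (ga 0))%:E)%E.
  rewrite -EFinB; congr EFin.
  rewrite -linearB /= -/u /dot; under eq_bigr do rewrite mxE -mulrA.
  rewrite -mulr_sumr -/(dot u u) -sqr_enorm -/w expr2 mulrA divfK//.
rewrite -FTC; apply: le_integral_nonneg => [s|s|s _].
- by rewrite /= !in_itv/= => /andP[-> h]; apply: (le_trans h); case/andP: t01.
- rewrite /= in_itv/= => st; rewrite lee_fin.
  have [_ /(_ (velocity c s))] := hc s st; apply: le_trans.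
  have s01 : 0 <= s <= 1 by lra.
  rewrite (C1_path_velocity_coord C1c s01 (charts s st)).
  apply: (le_trans (dot_le _ _)); rewrite /k enormZ -/w.
  have aw0 : 0 <= a / w by rewrite divr_ge0 ?ltW.
  by rewrite (ger0_norm aw0) (divfK w0) lexx.
- by rewrite lee_fin tangent_norm_ge0.
Qed.

End RiemannianDistance.

Section RiemannianDistanceLowerBound.
Context {R : realType} {m : nat} {M : smoothManifold R m}.
Variable g : riemannianMetric M.

Definition chart_ball (phi : chart R m M) (y : 'rV[R]_m) (r : R) : set M :=
  [set z | chart_dom phi z /\ enorm (phi z - y) <= r].

(** The inverse chart maps a compact ball onto this set, and M is Hausdorff. *)
Lemma closed_chart_ball phi y r :
  (forall w : 'rV[R]_m, enorm (w - y) <= r -> (phi @` chart_dom phi) w) ->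
  closed (chart_ball phi y r).
Proof.
move=> im; pose A := [set w : 'rV[R]_m | enorm (w - y) <= r].
have clA : closed A.
  rewrite (_ : A = (fun w : 'rV[R]_m => enorm (w - y)) @^-1` [set x | x <= r])//.
  apply: preimage_closed => [w _|]; last exact: closed_le.
  apply: (@continuous_comp _ _ _ (fun w : 'rV[R]_m => w - y)).
    by apply: continuousB; [exact: cvg_id|exact: cst_continuous].
  exact: continuous_enorm.
have cA : compact A.
  rewrite (iffLR (closure_id A) clA).
  apply: (@compact_closure_enorm _ _ _ (r + enorm y)) => w /= wr.
  by rewrite -(subrK y w); apply: (le_trans (enormD _ _)); rewrite lerD2r.
have -> : chart_ball phi y r = chart_inv phi @` A.
  apply/seteqP; split=> [z [dz zr]|_ [w wr <-]].
    by exists (phi z); [|rewrite chart_mapK].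
  have [z dz zw] := im w wr.
  by rewrite -zw chart_mapK//; split=> //; rewrite zw.
apply: compact_closed; first exact: manifold_hausdorff.
apply: continuous_compact => //.
apply: continuous_in_subspaceT => w; rewrite inE => wr.
exact/chart_inv_continuous/im.
Qed.

Section Truncation.
Variables (phi : chart R m M) (aphi : atlas phi) (y : 'rV[R]_m) (eta a : R).
Hypothesis (a_gt0 : 0 < a).
Hypothesis ball_im :
  forall w : 'rV[R]_m, enorm (w - y) <= eta -> (phi @` chart_dom phi) w.
Hypothesis ball_norm : forall z, chart_ball phi y eta z ->
  forall v : tangent M z, a * enorm (v phi) <= tangent_norm g v.

Let inside : set M := [set z | chart_dom phi z /\ enorm (phi z - y) < eta].

(** The coordinate distance to the centre of the ball, truncated at the radius
    and extended by the radius to all of M: it increases along a curve,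
    multiplied by a, by no more than the length, whether the curve leaves the
    ball or not. *)
Definition truncated_dist (z : M) : R :=
  if `[< inside z >] then enorm (phi z - y) else eta.

Lemma truncated_dist_le z : truncated_dist z <= eta.
Proof.
by rewrite /truncated_dist; case: asboolP => // -[_ /ltW].
Qed.

Lemma truncated_dist_in z : chart_dom phi z -> enorm (phi z - y) < eta ->
  truncated_dist z = enorm (phi z - y).
Proof. by move=> dz zeta; rewrite /truncated_dist asboolT. Qed.

Let inside_nbhs z : inside z -> nbhs z inside.
Proof.
move=> [dz zeta].
have d0 : 0 < eta - enorm (phi z - y) by rewrite subr_gt0.
have cphi := chart_map_continuous dz.
have := cphi _ (enorm_nbhs (phi z) d0); rewrite nbhs_simpl/=.
have : nbhs z (chart_dom phi).
  by apply: open_nbhs_nbhs; split => //; exact: chart_dom_open.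
apply: filterS2 => w dw /= wz; split=> //.
have -> : phi w - y = (phi w - phi z) + (phi z - y) by rewrite addrA subrK.
by apply: le_lt_trans (enormD _ _) _; lra.
Qed.

(** The estimate of the length is applied up to the first time at which the
    curve leaves the ball, or up to the end if it does not leave it. *)
Lemma truncated_dist_C1_path c : C1_path c ->
  ((a * truncated_dist (c 1))%:E <=
   (a * truncated_dist (c 0))%:E + path_length g c)%E.
Proof.
move=> C1c; have len0 := path_length_ge0 g c.
have [in0|out0] := pselect (inside (c 0)); last first.
  rewrite {2}/truncated_dist asboolF//; apply: (@le_trans _ _ (a * eta)%:E).
    by rewrite lee_fin ler_pM2l// truncated_dist_le.
  by rewrite leeDl.
have cc (s : R) : 0 <= s <= 1 -> {for s, continuous c}.
  by move=> s01; have [e e0 he] := C1c; have [] := he s; first by lra.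
(* t is the first time outside the ball, or 1 if there is none. *)
suff [t t01 [ct lt]] : exists2 t : R, 0 <= t <= 1 &
    (forall s, 0 <= s <= t -> chart_ball phi y eta (c s)) /\
    truncated_dist (c 1) <= enorm (phi (c t) - y).
  have h : ((a * enorm (phi (c t) - phi (c 0)))%:E <= path_length g c)%E.
    apply: path_length_ge_chart => // s st; have cs := ct s st.
    by split; [case: cs|exact: ball_norm].
  apply: le_trans (leeD (lexx _) h); rewrite -EFinD lee_fin -mulrDr.
  rewrite ler_pM2l//; apply: (le_trans lt).
  case: in0 => d0 e0; rewrite truncated_dist_in//.
  have -> : phi (c t) - y = (phi (c 0) - y) + (phi (c t) - phi (c 0)).
    by rewrite [RHS]addrC addrA subrK.
  exact: enormD.
pose E := [set s : R | 0 <= s <= 1 /\ ~ inside (c s)].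
have [[s0 Es0]|noE] := pselect (E !=set0); last first.
  have allin s : 0 <= s <= 1 -> inside (c s).
    by move=> s01; apply: contrapT => ns; apply: noE; exists s.
  exists 1; first by rewrite lexx ler01.
  split=> [s /allin[ds /ltW]//|].
  by have [|d1 e1] := allin 1; [rewrite lexx ler01|rewrite truncated_dist_in].
have infE : has_inf E.
  by split; [exists s0|exists 0 => s [] /andP[]].
pose t := inf E.
have t0 : 0 <= t by apply: lb_le_inf; [exists s0|move=> s [] /andP[]].
have tle s : E s -> t <= s by move=> Es; apply: ge_inf => //; case: infE.
have t1 : t <= 1 by apply: (le_trans (tle _ Es0)); case: Es0 => /andP[].
have before s : 0 <= s < t -> inside (c s).
  move=> st; apply: contrapT => ns.
  have /tle : E s by split => //; lra.
  by lra.
have outt : ~ inside (c t).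
  move=> /inside_nbhs /(cc t _); rewrite t0 t1 => /(_ isT).
  rewrite nbhs_simpl/= => /nbhs_ballP[e /= e0 he].
  have [s Es st] := inf_adherent e0 infE.
  have ts := tle _ Es.
  case: Es => _; apply; apply: he; rewrite /ball/= ltr_norml; apply/andP.
  by rewrite -/t in st; split; lra.
have tpos : 0 < t.
  rewrite lt_neqAle t0 andbT; apply/eqP => t00.
  by apply: outt; rewrite -t00.
have ballt : chart_ball phi y eta (c t).
  apply: (closed_cvg _ (closed_chart_ball ball_im)) (cvg_at_left_filter _);
    last by apply: cc; lra.
  near=> s; have [|ds /ltW es] := before s; last by split.
  by apply/andP; split; [near: s; exact: nbhs_left_ge|].
exists t; first by rewrite t0.
split=> [s /andP[s0' st]|].
  have [->//|sNt] := eqVneq s t.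
  have [|ds /ltW] := before s; last by split.
  by rewrite s0' lt_neqAle sNt st.
apply: (le_trans (truncated_dist_le _)); rewrite leNgt; apply/negP => lt.
by apply: outt; split=> //; case: ballt.
Unshelve. all: by end_near. Qed.

Lemma truncated_dist_path s p q : piecewise_C1_path p s q ->
  ((a * truncated_dist q)%:E <=
   (a * truncated_dist p)%:E + \sum_(c <- s) path_length g c)%E.
Proof.
elim: s p => [p /= ->|c s ih p /= [C1c <- /ih h]].
  by rewrite big_nil adde0.
rewrite big_cons addeA; apply: (le_trans h).
by apply: leeD => //; exact: truncated_dist_C1_path.
Qed.

End Truncation.

(** The truncated distance to p vanishes at p and is the coordinate distance at
    q, which lies in the ball of radius delta / 2 around p. *)
Lemma riemannian_dist_ge phi o delta a b (p q : M) : atlas phi ->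
  metric_pinched g phi o delta a b -> 0 < a ->
  chart_dom phi p -> chart_dom phi q ->
  enorm (phi p - o) < delta / 4 -> enorm (phi q - o) < delta / 4 ->
  ((a * enorm (phi p - phi q))%:E <= riemannian_dist g p q)%E.
Proof.
move=> aphi [ball_im pinch] a0 dp dq op oq.
have d0 : 0 < delta by have := enorm_ge0 (phi p - o); lra.
have near_o (w : 'rV[R]_m) : enorm (w - phi p) <= delta / 2 ->
    enorm (w - o) < delta.
  move=> wp; have -> : w - o = (w - phi p) + (phi p - o) by rewrite addrA subrK.
  by apply: le_lt_trans (enormD _ _) _; lra.
have eta0 : 0 < delta / 2 by lra.
have im (w : 'rV[R]_m) : enorm (w - phi p) <= delta / 2 ->
    (phi @` chart_dom phi) w.
  by move=> /near_o /ball_im.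
have norm z : chart_ball phi (phi p) (delta / 2) z ->
    forall v : tangent M z, a * enorm (v phi) <= tangent_norm g v.
  by move=> [dz /near_o zo] v; case/andP: (pinch z dz zo v).
apply: le_ereal_inf_tmp => _ [s /= ps <-].
have := truncated_dist_path aphi a0 im norm ps.
rewrite (truncated_dist_in dp) ?subrr ?enorm0// mulr0 add0e.
rewrite truncated_dist_in//; first by rewrite enormB.
have -> : phi q - phi p = (phi q - o) - (phi p - o) by rewrite opprB addrA subrK.
by apply: le_lt_trans (enormD _ _) _; rewrite enormN; lra.
Qed.

End RiemannianDistanceLowerBound.

(** * Linear changes of coordinates and isometric charts *)

Section SmoothLinear.
Context {R : realType}.
Implicit Types V W : normedModType R.

(** The expansion of order 1 at z only involves the values near z. *)
Lemma near_eq_differentiable V W (f h : V -> W) (z : V) :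
  (\forall w \near z, f w = h w) -> differentiable f z -> differentiable h z.
Proof.
move=> fh df; have [cd /eqaddoP E] := (diff_locallyP z f).1 df.
have E' : h \o shift z = cst (h z) + 'd f z +o_ (0 : V) id.
  apply/eqaddoP => e e0; have := E e e0.
  have : \forall w \near (0 : V), f (w + z) = h (w + z).
    have cz : {for (0 : V), continuous (fun w => w + z)}.
      by apply: continuousD; [exact: cvg_id|exact: cst_continuous].
    have fh0 : nbhs (0 + z) [set w | f w = h w] by rewrite add0r.
    exact: (cz _ fh0).
  apply: filterS2 => w fhw.
  by rewrite /= !fctE /= -fhw (nbhs_singleton fh).
by apply/diff_locallyP; rewrite (diff_unique cd E').
Qed.

Lemma Cn_on_eq V W n (f h : V -> W) (A : set V) : open A ->
  (forall z, A z -> f z = h z) -> Cn_on n f A -> Cn_on n h A.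
Proof.
move=> oA; elim: n f h => [|n ih] f h fh /=.
  move=> cf z Az; apply: (@near_eq_continuous _ _ _ f); last exact: cf.
  have : nbhs z A by exact: open_nbhs_nbhs.
  by apply: filterS => w /fh.
have near_fh z : A z -> \forall w \near z, f w = h w.
  move=> Az; have : nbhs z A by exact: open_nbhs_nbhs.
  by apply: filterS => w /fh.
move=> [df Df]; split=> [z Az|v].
  exact: near_eq_differentiable (near_fh z Az) (df z Az).
apply: ih (Df v) => z Az.
exact/near_eq_derive/near_fh.
Qed.

Lemma Cn_on_comp_linear V W W' n (L : {linear V -> W}) (f : W -> W')
    (A : set W) :
  continuous L -> open A -> Cn_on n f A -> Cn_on n (f \o L) (L @^-1` A).
Proof.
move=> cL oA; elim: n f => [|n ih] f /=.
  move=> cf z Az; have := continuous_comp (cL z) (cf _ Az); exact.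
move=> [df Df].
have dL z : differentiable L z by exact: linear_differentiable.
have dfL z : A (L z) -> differentiable (f \o L) z.
  by move=> Az; apply: differentiable_comp; [exact: dL|exact: df].
split=> [z Az|v]; first exact: dfL.
apply: Cn_on_eq (ih _ (Df (L v))).
  by apply: open_comp => // z _; exact: cL.
move=> z Az /=; rewrite deriveE; last exact: df.
rewrite deriveE; last exact: dfL.
rewrite (congr1 (fun h => h v) (diff_comp (dL z) (df _ Az))) /=.
by rewrite (diff_lin z cL).
Qed.

Lemma Cn_on_linear_comp V W W' n (L : {linear W -> W'}) (f : V -> W)
    (A : set V) :
  continuous L -> open A -> Cn_on n f A -> Cn_on n (L \o f) A.
Proof.
move=> cL oA; elim: n f => [|n ih] f /=.
  move=> cf z Az; have := continuous_comp (cf _ Az) (cL (f z)); exact.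
move=> [df Df].
have dL z : differentiable L z by exact: linear_differentiable.
have dLf z : A z -> differentiable (L \o f) z.
  by move=> Az; apply: differentiable_comp; [exact: df|exact: dL].
split=> [z Az|v]; first exact: dLf.
apply: Cn_on_eq (ih _ (Df v)) => // z Az /=.
rewrite deriveE; last exact: df.
rewrite deriveE; last exact: dLf.
rewrite (congr1 (fun h => h v) (diff_comp (df _ Az) (dL (f z)))) /=.
by rewrite (diff_lin (f z) cL).
Qed.

End SmoothLinear.

Section LinearChart.
Context {R : realType} {m : nat} {M : smoothManifold R m}.
Implicit Types (x : M) (phi psi chi : chart R m M).

Lemma open_overlap phi chi : atlas phi -> atlas chi -> open (overlap phi chi).
Proof.
move=> aphi achi; rewrite openE => _ [z [dz dz'] <-].
have := near_overlap (conj aphi dz) (conj achi dz'); apply: filterS => w.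
by move=> [[p dp <-]]; rewrite chart_mapK// => dp'; exists p.
Qed.

Section Construction.
Variables (phi : chart R m M) (A : 'M[R]_m).
Hypothesis Au : A \in unitmx.

Let mulA_continuous (B : 'M[R]_m) : continuous (fun y : 'rV[R]_m => y *m B).
Proof. exact: (@linear_rV_continuous _ _ _ (mulmxr B)). Qed.

Let mulAK : cancel (fun y : 'rV[R]_m => y *m A) (fun y => y *m invmx A).
Proof. by move=> y; rewrite mulmxK. Qed.

Let mulVK : cancel (fun y : 'rV[R]_m => y *m invmx A) (fun y => y *m A).
Proof. by move=> y; rewrite mulmxKV. Qed.

Let linear_map (z : M) := phi z *m A.
Let linear_inv (y : 'rV[R]_m) := chart_inv phi (y *m invmx A).

Let linear_map_continuous z : chart_dom phi z -> {for z, continuous linear_map}.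
Proof.
move=> /chart_map_continuous cz.
by have := continuous_comp cz (@mulA_continuous A (phi z)); exact.
Qed.

Let linear_imageE : linear_map @` chart_dom phi =
  (fun y : 'rV[R]_m => y *m invmx A) @^-1` (phi @` chart_dom phi).
Proof.
apply/seteqP; split=> [_ [z dz <-]|y [z dz zy]] /=.
  by exists z => //; rewrite /linear_map mulAK.
by exists z => //; rewrite /linear_map zy mulVK.
Qed.

Let linear_img_open : open (linear_map @` chart_dom phi).
Proof.
rewrite linear_imageE; apply: open_comp; last exact: chart_img_open.
by move=> y _; exact: mulA_continuous.
Qed.

Let linear_mapK z : chart_dom phi z -> linear_inv (linear_map z) = z.
Proof. by move=> dz; rewrite /linear_inv /linear_map mulAK chart_mapK. Qed.

Let linear_inv_continuous y : (linear_map @` chart_dom phi) y ->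
  {for y, continuous linear_inv}.
Proof.
rewrite linear_imageE => /chart_inv_continuous cy.
by have := continuous_comp (@mulA_continuous (invmx A) y) cy; exact.
Qed.

Definition linear_chart : chart R m M :=
  Chart (@chart_dom_open _ _ _ phi) (@chart_relatively_compact _ _ _ phi)
    linear_map_continuous linear_img_open linear_mapK linear_inv_continuous.

(** The atlas is maximal, and composition with linear maps preserves
    smoothness. *)
Lemma linear_chart_atlas : atlas phi -> atlas linear_chart.
Proof.
move=> aphi; apply: atlas_maximal => chi achi.
have [s1 s2] := atlas_compatible aphi achi.
split=> n.
  have -> : overlap linear_chart chi =
      (mulmxr (invmx A) : 'rV[R]_m -> 'rV[R]_m) @^-1` overlap phi chi.
    apply/seteqP; split=> [_ [z dz <-]|y [z dz zy]] /=.
      by exists z => //; rewrite /linear_map mulAK.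
    by exists z => //=; rewrite /linear_map zy /= mulVK.
  apply: (@Cn_on_comp_linear _ _ _ _ _ (mulmxr (invmx A)) (transition phi chi)).
  - exact: mulA_continuous.
  - exact: open_overlap.
  - exact: (s1 n).
apply: (@Cn_on_linear_comp _ _ _ _ _ (mulmxr A) (transition chi phi)).
- exact: mulA_continuous.
- exact: (open_overlap achi aphi).
- exact: (s2 n).
Qed.

Lemma linear_chart_coord z (v : tangent M z) : charts_at z phi ->
  v linear_chart = v phi *m A.
Proof.
move=> hphi; have hlin : charts_at z linear_chart.
  by split; [apply: linear_chart_atlas; case: hphi|case: hphi].
have /asboolP[_ /(_ phi linear_chart hphi hlin) ->] := tangent_coordP v.
have dt := transition_differentiable hphi hphi.
have cA := @mulA_continuous A.
have dA : differentiable (mulmxr A : 'rV[R]_m -> 'rV[R]_m)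
    (transition phi phi (phi z)) by exact: linear_differentiable.
apply: (etrans (congr1 (fun h => h (v phi)) (diff_comp dt dA))).
have lA := @diff_lin R _ _ (mulmxr A : {linear 'rV[R]_m -> 'rV[R]_m})
  (transition phi phi (phi z)) cA.
apply: (etrans
  (congr1 (fun h => h ('d (transition phi phi) (phi z) (v phi))) lA)).
by congr (_ *m A); exact: diff_transition_id.
Qed.

End Construction.
End LinearChart.

Section MetricCoordinates.
Context {R : realType} {m : nat} {M : smoothManifold R m}.
Variable g : riemannianMetric M.
Implicit Types (x z : M) (phi psi : chart R m M).

Lemma metric_suml z (I : finType) (a : I -> R) (e : I -> tangent M z) w :
  metric g (\sum_i a i *: e i) w = \sum_i a i * metric g (e i) w.
Proof.
have g0 : metric g (0 : tangent M z) w = 0.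
  have := metric_linear g w 1 0 0; rewrite scale1r addr0 mul1r => h.
  by apply: (addrI (metric g (0 : tangent M z) w)); rewrite addr0 -h.
elim: (index_enum I) => [|i r ih]; first by rewrite !big_nil.
by rewrite !big_cons metric_linear ih.
Qed.

Lemma tangent_coord_sum z phi (v : tangent M z) : charts_at z phi ->
  v = \sum_i v phi 0 i *: vec_of_coord phi z (delta_mx 0 i).
Proof.
move=> hphi; apply: (tangent_coord_inj hphi).
rewrite -[RHS]chart_diffE linear_sum {1}(row_sum_delta (v phi)).
apply: eq_bigr => i _; rewrite linearZ; congr (_ *: _).
by rewrite /= chart_diffE vec_of_coordK.
Qed.

Lemma metric_coordE z phi (v : tangent M z) : charts_at z phi ->
  metric g v v = \sum_i \sum_j v phi 0 i * v phi 0 j *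
    metric g (vec_of_coord phi z (delta_mx 0 i))
             (vec_of_coord phi z (delta_mx 0 j)).
Proof.
move=> hphi; set e := fun i => vec_of_coord phi z (delta_mx 0 i).
have gE w : metric g v w = \sum_j v phi 0 j * metric g (e j) w.
  by rewrite -metric_suml -tangent_coord_sum.
rewrite gE; apply: eq_bigr => i _; rewrite Defs.metric_sym gE mulr_sumr.
by apply: eq_bigr => j _; rewrite mulrA; congr (_ * _); exact: Defs.metric_sym.
Qed.

Definition gram z phi : 'M[R]_m := \matrix_(i, j)
  metric g (vec_of_coord phi z (delta_mx 0 i))
           (vec_of_coord phi z (delta_mx 0 j)).

Lemma metric_gram z phi (v : tangent M z) : charts_at z phi ->
  metric g v v = (v phi *m gram z phi *m (v phi)^T) 0 0.
Proof.
move=> hphi; rewrite (metric_coordE v hphi) mxE exchange_big /=.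
apply: eq_bigr => j _; rewrite !mxE mulr_suml; apply: eq_bigr => i _.
by rewrite mxE; ring.
Qed.

(** The differential of psi at x is an isometry onto the Euclidean space. *)
Definition isometric_chart x psi : Prop := charts_at x psi /\
  forall v : tangent M x, tangent_norm g v = enorm (v psi).

Lemma isometric_chart_exists x phi : charts_at x phi ->
  exists A psi, [/\ A \in unitmx, isometric_chart x psi,
    chart_dom psi = chart_dom phi, forall z, psi z = phi z *m A &
    forall v : tangent M x, v psi = v phi *m A].
Proof.
move=> hphi; have [aphi dx] := hphi.
have [||A Au GE] := @cholesky R m (gram x phi).
- by apply/matrixP => i j; rewrite !mxE Defs.metric_sym.
- move=> u u0; rewrite -(vec_of_coordK u hphi) -metric_gram//.
  apply: metric_pos; apply: contra u0 => /eqP u0.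
  by rewrite -(vec_of_coordK u hphi) u0.
exists A, (linear_chart phi Au); split=> //; last first.
  by move=> v; exact: linear_chart_coord.
split; first by split=> //; exact: linear_chart_atlas.
move=> v; rewrite (linear_chart_coord Au v hphi).
rewrite /tangent_norm (metric_gram v hphi) GE mulmxA -mulmxA -trmx_mul mxE.
by congr Num.sqrt; apply: eq_bigr => i _; rewrite [X in _ * X]mxE expr2.
Qed.

(** The Gram matrix is continuous; if its entries vary by at most eta, the
    quadratic form varies by at most m^2 eta times the squared norm. *)
Lemma isometric_chart_pinched x psi (e : R) : isometric_chart x psi ->
  0 < e < 1 ->
  exists2 delta, 0 < delta & metric_pinched g psi (psi x) delta (1 - e) (1 + e).
Proof.
move=> [[apsi dx] iso] /andP[e0 e1].
pose h i j (y : 'rV[R]_m) : R :=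
  metric g (vec_of_coord psi (chart_inv psi y) (delta_mx 0 i))
           (vec_of_coord psi (chart_inv psi y) (delta_mx 0 j)).
have imx : (psi @` chart_dom psi) (psi x) by exists x.
have ch i j : {for psi x, continuous (h i j)}.
  by have := metric_smooth g apsi (delta_mx 0 i) (delta_mx 0 j) 0%N; exact.
pose eta := e / (m * m).+1%:R.
have eta0 : 0 < eta by rewrite divr_gt0.
have : \forall y \near psi x, (psi @` chart_dom psi) y /\
    forall ij : 'I_m * 'I_m, `|h ij.1 ij.2 y - h ij.1 ij.2 (psi x)| <= eta.
  apply: filterI.
    by apply: open_nbhs_nbhs; split => //; exact: chart_img_open.
  have near_h (ij : 'I_m * 'I_m) : \forall y \near psi x,
      `|h ij.1 ij.2 y - h ij.1 ij.2 (psi x)| <= eta.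
    have /cvgrPdist_le/(_ _ eta0) hle := ch ij.1 ij.2.
    by near=> y; rewrite distrC; near: y.
  exact: filter_forall near_h.
move=> /nbhs_enorm[delta delta0 hd]; exists delta => //; split.
  by move=> y /hd[].
move=> z dz /hd[_ hz] v.
set u := v psi; have u0 : 0 <= enorm u := enorm_ge0 u.
have hpsi : charts_at z psi by [].
have gE : metric g v v = \sum_i \sum_j u 0 i * u 0 j * h i j (psi z).
  by rewrite (metric_coordE v hpsi) /h chart_mapK.
have gE0 : enorm u ^+ 2 = \sum_i \sum_j u 0 i * u 0 j * h i j (psi x).
  have hx : charts_at x psi by [].
  pose w := vec_of_coord psi x u.
  have wu : w psi = u by rewrite vec_of_coordK.
  rewrite -wu -iso /tangent_norm sqr_sqrtr.
    by rewrite (metric_coordE w hx) wu /h chart_mapK.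
  have [->|w0] := eqVneq w 0; last by rewrite ltW// metric_pos.
  rewrite (metric_coordE _ hx) big1// => i _; rewrite big1// => j _.
  by rewrite mxE !mul0r.
have close : `|metric g v v - enorm u ^+ 2| <= e * enorm u ^+ 2.
  rewrite gE [in leLHS]gE0 -sumrB; apply: (le_trans (ler_norm_sum _ _ _)).
  apply: (@le_trans _ _ (\sum_(i < m) \sum_(j < m) eta * enorm u ^+ 2)).
    apply: ler_sum => i _; rewrite -sumrB; apply: (le_trans (ler_norm_sum _ _ _)).
    apply: ler_sum => j _; rewrite -mulrBr normrM mulrC.
    apply: ler_pM => //; first exact: (hz (i, j)).
    by rewrite normrM expr2; apply: ler_pM => //; exact: le_coord_enorm.
  rewrite !sumr_const !card_ord -mulrnA -[leLHS]mulr_natl mulrA.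
  apply: ler_wpM2r; first exact: sqr_ge0.
  by rewrite /eta mulrA ler_pdivrMr// mulrC ler_pM2l// ler_nat.
have g0 : 0 <= metric g v v.
  have [->|v0] := eqVneq v 0; last by rewrite ltW// metric_pos.
  rewrite (metric_coordE _ hpsi) big1// => i _; rewrite big1// => j _.
  by rewrite mxE !mul0r.
move: close; rewrite ler_norml => /andP[c1 c2].
have N0 := tangent_norm_ge0 g v.
have NE : tangent_norm g v ^+ 2 = metric g v v by rewrite sqr_sqrtr.
have a0 : 0 <= (1 - e) * enorm u by rewrite mulr_ge0// subr_ge0 ltW.
have b0 : 0 <= (1 + e) * enorm u by rewrite mulr_ge0// addr_ge0 ?ltW.
have ee : 0 <= e * (1 - e) * enorm u ^+ 2.
  by rewrite mulr_ge0 ?sqr_ge0// mulr_ge0 ?subr_ge0 ?ltW.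
have ee' : 0 <= e * (1 + e) * enorm u ^+ 2.
  by rewrite mulr_ge0 ?sqr_ge0// mulr_ge0 ?addr_ge0 ?ltW.
apply/andP; split.
  rewrite -(@ler_pXn2r _ 2)// ?nnegrE// NE exprMn; nra.
rewrite -(@ler_pXn2r _ 2)// ?nnegrE// NE exprMn; nra.
Unshelve. all: by end_near. Qed.

End MetricCoordinates.

(** * Blow-ups of the Riemannian and the Euclidean Hausdorff measures *)

Section Comparison.
Context {R : realType} {m : nat} {M : smoothManifold R m}.
Variables (g : riemannianMetric M) (k : nat).
Implicit Types (phi psi : chart R m M) (x : M) (S E : set M).

Lemma euclidean_dist_ge0 n (y z : 'rV[R]_n) : (0 <= Defs.edist y z)%E.
Proof. by rewrite edistE lee_fin enorm_ge0. Qed.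

Lemma nonneg_hausdorff (S : set 'rV[R]_m) :
  nonneg_set_function (Defs.mrestrict (hausdorff Defs.edist k) S).
Proof.
split=> [|B]; rewrite /Defs.mrestrict ?setI0.
  by apply: hausdorff0; exact: euclidean_dist_ge0.
by apply: hausdorff_ge0; exact: euclidean_dist_ge0.
Qed.

Lemma nonneg_rescaled_pushforward phi S x (r : R) : 0 <= r ->
  nonneg_set_function (rescaled_pushforward g k phi S x r).
Proof.
move=> r0; split=> [|B]; rewrite /rescaled_pushforward /Defs.mrestrict.
  rewrite preimage_set0 !setI0 hausdorff0 ?mule0//.
  exact: riemannian_dist_ge0.
rewrite mule_ge0 ?lee_fin ?invr_ge0 ?exprn_ge0//.
by apply: hausdorff_ge0; exact: riemannian_dist_ge0.
Qed.

Lemma tangent_dist_ge0 x (v w : tangent M x) : (0 <= tangent_dist g v w)%E.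
Proof. by rewrite lee_fin sqrtr_ge0. Qed.

Lemma nonneg_tangent_pushforward phi x T :
  nonneg_set_function (tangent_pushforward g k phi (x := x) T).
Proof.
split=> [|B]; rewrite /tangent_pushforward /Defs.mrestrict.
  rewrite preimage_set0 setI0; apply: hausdorff0; exact: tangent_dist_ge0.
by apply: hausdorff_ge0; exact: tangent_dist_ge0.
Qed.

Lemma weak_star_cvg_eq (mu mu' : R -> set 'rV[R]_m -> \bar R) nu :
  (forall r, 0 < r -> mu r = mu' r) -> weak_star_cvg mu nu ->
  weak_star_cvg mu' nu.
Proof.
move=> mumu' munu f cf sf; apply: cvg_trans (munu f cf sf).
apply: near_eq_cvg; have := @nbhs_right_gt R 0; apply: filterS => r r0.
by rewrite mumu'.
Qed.

(** The rescaled measures are nonnegative at nonnegative scales only, while the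
    limit sees positive ones. *)
Lemma weak_star_cvg_norm (mu : R -> set 'rV[R]_m -> \bar R) nu :
  weak_star_cvg mu nu <-> weak_star_cvg (fun r => mu `|r|) nu.
Proof. by split; apply: weak_star_cvg_eq => r r0; rewrite gtr0_norm. Qed.

Lemma blowup_enorm (y z w : 'rV[R]_m) (r : R) : 0 < r ->
  enorm (blowup y r z - blowup y r w) = r^-1 * enorm (z - w).
Proof.
move=> r0; rewrite /blowup -scalerBr enormZ gtr0_norm ?invr_gt0//.
by rewrite opprB addrA subrK.
Qed.

Lemma blowup0 (y : 'rV[R]_m) (r : R) : blowup y r y = 0.
Proof. by rewrite /blowup subrr scaler0. Qed.

Lemma enorm_blowup (y z : 'rV[R]_m) (r : R) : 0 < r ->
  enorm (blowup y r z) = r^-1 * enorm (z - y).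
Proof. by move=> r0; rewrite -(blowup_enorm y)// blowup0 subr0. Qed.

Lemma blowupK (y z : 'rV[R]_m) (r : R) : 0 < r -> y + r *: blowup y r z = z.
Proof.
by move=> r0; rewrite /blowup scalerA divff ?gt_eqF// scale1r addrC subrK.
Qed.

Definition chart_blowup phi x (r : R) (z : M) : 'rV[R]_m :=
  blowup (phi x) r (phi z).

Lemma hausdorff_chart_blowup_le phi x E (r a : R) : 0 < r -> 0 < a ->
  (forall p q, E p -> E q ->
     ((a * enorm (phi p - phi q))%:E <= riemannian_dist g p q)%E) ->
  (hausdorff Defs.edist k (chart_blowup phi x r @` E) <=
   ((r * a) ^- k)%:E * hausdorff (riemannian_dist g) k E)%E.
Proof.
move=> r0 a0 h; rewrite -exprVn; apply: hausdorff_lipschitz.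
- exact: riemannian_dist_ge0.
- exact: euclidean_dist_ge0.
- by rewrite invr_gt0 mulr_gt0.
move=> p q Ep Eq; rewrite edistE blowup_enorm// lee_pdivlMl ?mulr_gt0//.
rewrite -EFinM mulrACA divff ?gt_eqF// mul1r; exact: h.
Qed.

Lemma hausdorff_chart_blowup_ge phi x E (r b : R) : 0 < r -> 0 < b ->
  E `<=` chart_dom phi ->
  (forall p q, E p -> E q ->
     (riemannian_dist g p q <= (b * enorm (phi p - phi q))%:E)%E) ->
  (hausdorff (riemannian_dist g) k E <=
   ((r * b) ^+ k)%:E * hausdorff Defs.edist k (chart_blowup phi x r @` E))%E.
Proof.
move=> r0 b0 Edom h.
pose f (w : 'rV[R]_m) := chart_inv phi (phi x + r *: w).
have fK z : E z -> f (chart_blowup phi x r z) = z.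
  by move=> /Edom dz; rewrite /f blowupK// chart_mapK.
apply: (@hausdorff_le_lipschitz _ _ _ _ _ _ f).
- exact: euclidean_dist_ge0.
- exact: riemannian_dist_ge0.
- by rewrite mulr_gt0.
- move=> _ _ [p Ep <-] [q Eq <-]; rewrite !fK//.
  rewrite edistE blowup_enorm// -EFinM mulrACA divff ?gt_eqF// mul1r.
  exact: h.
- by move=> z Ez; exists (chart_blowup phi x r z); [exists z|exact: fK].
Qed.

Lemma chart_image_blowupE phi S x (r : R) (B : set 'rV[R]_m) :
  blowup (phi x) r @` chart_image phi S `&` B =
  chart_blowup phi x r @`
    (S `&` (chart_dom phi `&` (blowup (phi x) r \o phi) @^-1` B)).
Proof.
apply/seteqP; split=> [w [[_ [z [Sz dz] <-] <-] Bw]|_ [z [Sz [dz Bz]] <-]].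
  by exists z.
by split=> //; exists (phi z) => //; exists z.
Qed.

Lemma expr_near1 (e : R) : 0 < e ->
  exists2 t, 0 < t < 1 & (1 + t) ^+ k <= 1 + e /\ (1 - t) ^- k <= 1 + e.
Proof.
move=> e0.
have c1 : {for (0 : R), continuous (fun t : R => (1 + t) ^+ k)}.
  apply: (@continuous_comp _ _ _ (fun t : R => 1 + t) (fun t => t ^+ k)).
    by apply: continuousD; [exact: cst_continuous|exact: cvg_id].
  exact: exprn_continuous.
have c2 : {for (0 : R), continuous (fun t : R => (1 - t) ^+ k)}.
  apply: (@continuous_comp _ _ _ (fun t : R => 1 - t) (fun t => t ^+ k)).
    by apply: continuousB; [exact: cst_continuous|exact: cvg_id].
  exact: exprn_continuous.
have h1 : \forall t \near (0 : R), (1 + t) ^+ k < 1 + e.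
  by apply: (cvgr_lt _ c1); rewrite addr0 expr1n ltrDl.
have h2 : \forall t \near (0 : R), (1 + e)^-1 < (1 - t) ^+ k.
  by apply: (cvgr_gt _ c2); rewrite subr0 expr1n invf_lt1 ?ltrDl// addr_gt0.
have [d /= d0 hd] := (nbhs_ballP _ _).1 (filterI h1 h2).
exists (Num.min (1 / 2) (d / 2)).
  by rewrite lt_min gt_min !divr_gt0//= ltr_pdivrMr// mul1r ltr1n.
set t := Num.min _ _; have t0 : 0 < t by rewrite lt_min !divr_gt0.
have t1 : t < 1 by rewrite gt_min ltr_pdivrMr// mul1r ltr1n.
have [|h3 h4] := hd t.
  rewrite /ball /= sub0r normrN gtr0_norm// gt_min; apply/orP; right.
  by rewrite ltr_pdivrMr// mulr_natr mulr2n ltrDl.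
split; first exact: ltW.
rewrite -[leRHS]invrK lef_pV2 ?posrE ?exprn_gt0 ?subr_gt0 ?invr_gt0 ?addr_gt0//.
exact: ltW.
Qed.

(** On the ball of radius rho at scale r, with r rho < delta / 4, the dilated
    chart multiplies distances by 1 / r up to the factors 1 - t and 1 + t, and
    the Hausdorff measures by the powers k of these. *)
Lemma locally_asymp_equiv_chart psi S x : isometric_chart g x psi ->
  locally_asymp_equiv
    (fun r => Defs.mrestrict (hausdorff Defs.edist k)
                (blowup (psi x) r @` chart_image psi S))
    (fun r => rescaled_pushforward g k psi S x `|r|).
Proof.
move=> iso rho e rho0 e0; have [[apsi dx] _] := iso.
have [t t01 [le1 le2]] := expr_near1 e0.
have [delta delta0 pinch] := isometric_chart_pinched iso t01.
case/andP: t01 => t0 t1.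
have a0 : 0 < 1 - t by rewrite subr_gt0.
have b0 : 0 < 1 + t by rewrite addr_gt0.
near=> r => B Brho.
have r0 : 0 < r by near: r; exact: nbhs_right_gt.
have rd : r * rho < delta / 4.
  rewrite -ltr_pdivlMr//; near: r; apply: nbhs_right_lt.
  by rewrite !divr_gt0.
set E := S `&` (chart_dom psi `&` (blowup (psi x) r \o psi) @^-1` B).
have Edom : E `<=` chart_dom psi by move=> z [_ []].
have Eclose z : E z -> enorm (psi z - psi x) < delta / 4.
  move=> [_ [_ /Brho /=]]; rewrite enorm_blowup// => zr; apply: le_lt_trans rd.
  by rewrite -ler_pdivrMl.
have muE : Defs.mrestrict (hausdorff Defs.edist k)
    (blowup (psi x) r @` chart_image psi S) B =
    hausdorff Defs.edist k (chart_blowup psi x r @` E).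
  by rewrite /Defs.mrestrict chart_image_blowupE.
have mu'E : rescaled_pushforward g k psi S x `|r| B =
    ((r ^- k)%:E * hausdorff (riemannian_dist g) k E)%E.
  by rewrite gtr0_norm.
have H0 : (0 <= hausdorff (riemannian_dist g) k E)%E.
  by apply: hausdorff_ge0; exact: riemannian_dist_ge0.
have H0' : (0 <= hausdorff Defs.edist k (chart_blowup psi x r @` E))%E.
  by apply: hausdorff_ge0; exact: euclidean_dist_ge0.
rewrite muE mu'E; split.
  have := @hausdorff_chart_blowup_ge psi x E r (1 + t) r0 b0 Edom.
  move=> /(_ _)/(lee_wpmul2l _) le.
  apply: (@le_trans _ _ ((r ^- k)%:E * (((r * (1 + t)) ^+ k)%:E *
      hausdorff Defs.edist k (chart_blowup psi x r @` E)))%E).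
    apply: le; first by rewrite lee_fin invr_ge0 exprn_ge0// ltW.
    move=> p q Ep Eq; apply: (riemannian_dist_le apsi pinch) => //.
    - exact: ltW.
    - exact: Edom.
    - exact: Edom.
    - exact: Eclose.
    - exact: Eclose.
  rewrite muleA -EFinM exprMn mulrA mulVf ?mul1r; last first.
    by rewrite expf_neq0// gt_eqF.
  by apply: lee_wpmul2r => //; rewrite lee_fin.
apply: le_trans (@hausdorff_chart_blowup_le psi x E r (1 - t) r0 a0 _) _.
  move=> p q Ep Eq; apply: (riemannian_dist_ge apsi pinch) => //.
  - exact: Edom.
  - exact: Edom.
  - exact: Eclose.
  - exact: Eclose.
rewrite muleA -EFinM; apply: lee_wpmul2r => //; rewrite lee_fin exprMn invfM.
by rewrite mulrC; apply: ler_wpM2r => //; rewrite invr_ge0 exprn_ge0// ltW.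
Unshelve. all: by end_near. Qed.

Lemma tangent_pushforward_isometric psi x (T : {vspace tangent M x}) :
  isometric_chart g x psi ->
  tangent_pushforward g k psi T =
  Defs.mrestrict (hausdorff Defs.edist k) [set` (chart_diff psi x @: T)%VS].
Proof.
move=> [hpsi iso]; apply/funext => B.
rewrite /tangent_pushforward /Defs.mrestrict.
set f := chart_diff psi x.
have fE v : f v = v psi := chart_diffE psi v.
have dist v w : tangent_dist g v w = Defs.edist (f v) (f w).
  have fB : f v - f w = f (v - w) by rewrite linearB.
  by rewrite edistE fB fE -iso.
have -> : [set` (f @: T)%VS] `&` B = f @` ([set` T] `&` f @^-1` B).
  apply/seteqP; split=> [y [/memv_imgP[v vT ->] Bv]|_ [v [vT Bv] <-]].
    by exists v.
  by split => //; exact: memv_img.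
set D := _ `&` _; apply/eqP; rewrite eq_le; apply/andP; split.
  rewrite -[leRHS]mul1e -(expr1n _ k).
  apply: (@hausdorff_le_lipschitz _ _ _ _ _ _ (vec_of_coord psi x)) => //.
  - exact: euclidean_dist_ge0.
  - exact: (@tangent_dist_ge0 x).
  - move=> _ _ [v _ <-] [w _ <-]; rewrite mul1e dist !fE !tangent_coordK//.
  - by move=> v Dv; exists (f v); [exists v|rewrite fE tangent_coordK].
rewrite -[leRHS]mul1e -(expr1n _ k); apply: hausdorff_lipschitz => //.
- exact: tangent_dist_ge0.
- exact: euclidean_dist_ge0.
- by move=> v w _ _; rewrite mul1e dist.
Qed.

Lemma weak_star_cvg_linear_chart phi psi (A : 'M[R]_m) S x
    (T : {vspace tangent M x}) :
  A \in unitmx -> chart_dom psi = chart_dom phi ->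
  (forall z, psi z = phi z *m A) ->
  (forall v : tangent M x, v psi = v phi *m A) ->
  weak_star_cvg (rescaled_pushforward g k psi S x)
                (tangent_pushforward g k psi T) ->
  weak_star_cvg (rescaled_pushforward g k phi S x)
                (tangent_pushforward g k phi T).
Proof.
move=> Au dE psiE vE /weak_star_cvg_norm h; apply/weak_star_cvg_norm; move: h.
apply: (@weak_star_cvg_linear _ _ (mulmxr (invmx A)) (mulmxr A)).
- by move=> r; exact: nonneg_rescaled_pushforward.
- by move=> r; exact: nonneg_rescaled_pushforward.
- exact: nonneg_tangent_pushforward.
- exact: nonneg_tangent_pushforward.
- by move=> y; rewrite /= mulmxKV.
- by move=> y; rewrite /= mulmxK.
- move=> r B; rewrite /rescaled_pushforward dE.
  congr (_ * Defs.mrestrict _ _ (_ `&` _))%E; apply/funext => z.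
  by rewrite /preimage /= /blowup !psiE -mulmxBl scalemxAl mulmxK.
- move=> B; rewrite /tangent_pushforward; congr (Defs.mrestrict _ _ _).
  apply/funext => v; rewrite /preimage /= !chart_diffE vE mulmxK//.
Qed.

End Comparison.

(** * Independence of the tangent space from the chart *)

Section Subspaces.
Context {R : realType} {m : nat}.
Implicit Types (T : {vspace 'rV[R]_m}).

(** The projection along T to a complement is bounded, kills T and does not
    kill v. *)
Lemma vspace_separated T (v : 'rV[R]_m) : v \notin T ->
  exists2 rho, 0 < rho & forall t, t \in T -> rho <= enorm (t - v).
Proof.
move=> vT; pose lam : 'End('rV[R]_m) := (\1 - projv T)%VF.
have lamE u : lam u = u - projv T u by rewrite /lam !lfun_simp.
have [C C0 HC] := linear_enorm_bounded lam.
have lamv : lam v != 0.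
  rewrite lamE subr_eq0; apply: contra vT => /eqP ->; exact: memv_proj.
exists (enorm (lam v) / C).
  rewrite divr_gt0// lt_neqAle enorm_ge0 andbT eq_sym.
  by apply: contra lamv => /eqP /enorm_eq0 ->.
move=> t tT; rewrite ler_pdivrMr// mulrC enormB; apply: le_trans (HC _).
have lamt : lam t = 0 by rewrite lamE projv_id// subrr.
by rewrite linearB /= lamt subr0.
Qed.

Lemma vspace_linear_onto T T' : \dim T = \dim T' ->
  exists (f f' : {linear 'rV[R]_m -> 'rV[R]_m}),
    forall t, t \in T' -> f' t \in T /\ f (f' t) = t.
Proof.
move=> dimE.
have [e [fe eT]] : exists e : (\dim T').-tuple 'rV[R]_m,
    free e /\ (forall i : 'I_(\dim T'), e`_i \in T).
  rewrite -dimE; exists (vbasis T); split.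
    by have /andP[] := vbasisP T.
  by move=> i; apply: vbasis_mem; rewrite mem_nth// size_tuple.
pose comb (X Y : (\dim T').-tuple 'rV[R]_m) (u : 'rV[R]_m) : 'rV[R]_m :=
  \sum_i coord X i u *: Y`_i.
have comb_lin X Y : linear (comb X Y).
  move=> a u w; rewrite /comb scaler_sumr -big_split /=.
  by apply: eq_bigr => i _; rewrite linearP scalerDl scalerA.
pose comb_mixin X Y :=
  GRing.isLinear.Build R 'rV[R]_m 'rV[R]_m *:%R (comb X Y) (comb_lin X Y).
pose combL X Y : {linear 'rV[R]_m -> 'rV[R]_m} :=
  HB.pack (comb X Y) (comb_mixin X Y).
exists (combL e (vbasis T')), (combL (vbasis T') e) => t tT'; split.
  by apply: memv_suml => i _; apply: memvZ; exact: eT.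
rewrite [RHS](coord_vbasis tT') /= /comb; apply: eq_bigr => i _.
by rewrite coord_sum_free.
Qed.

(** The affine map that sends v to 0, dilates and then maps T onto T' is
    Lipschitz, and maps a ball around v onto a set that contains the ball of
    radius N in T' if the dilation is large enough. *)
Lemma hausdorff_null_subspaces k T T' (v : 'rV[R]_m) (rho N : R) :
  \dim T = \dim T' -> v \in T -> 0 < rho -> 0 < N ->
  hausdorff Defs.edist k ([set` T] `&` [set w | enorm (w - v) < rho]) = 0%E ->
  hausdorff Defs.edist k ([set` T'] `&` [set w | enorm w <= N]) = 0%E.
Proof.
move=> dimE vT rho0 N0 null; have [f [f' ff']] := vspace_linear_onto dimE.
have [C C0 HC] := linear_enorm_bounded f.
have [C' C'0 HC'] := linear_enorm_bounded f'.
(* The factor 2 makes the image of the ball of radius N stay inside the open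
   ball of radius rho after division by K. *)
pose K := 2 * C' * N / rho.
have K0 : 0 < K by rewrite divr_gt0// !mulr_gt0.
apply/eqP; rewrite eq_le; apply/andP; split; last first.
  by apply: hausdorff_ge0; exact: euclidean_dist_ge0.
rewrite -[leRHS](mule0 ((C * K) ^+ k)%:E) -null.
apply: (@hausdorff_le_lipschitz _ _ _ _ _ _ (fun w => f (K *: (w - v)))).
- exact: euclidean_dist_ge0.
- exact: euclidean_dist_ge0.
- exact: mulr_gt0.
- move=> y z _ _; rewrite !edistE -EFinM lee_fin.
  have -> : f (K *: (y - v)) - f (K *: (z - v)) = f (K *: (y - z)).
    by rewrite -linearB -scalerBr opprB addrA subrK.
  by apply: (le_trans (HC _)); rewrite enormZ gtr0_norm// mulrA.
- move=> t [tT' tN]; have [f't ft] := ff' t tT'.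
  exists (v + K^-1 *: f' t); last first.
    by rewrite (addrC v) addrK scalerA mulfV ?gt_eqF// scale1r.
  split=> /=; first by rewrite memvD// memvZ.
  rewrite (addrC v) addrK enormZ gtr0_norm ?invr_gt0// ltr_pdivrMl//.
  apply: (le_lt_trans (HC' _)).
  apply: (@le_lt_trans _ _ (C' * N)); first by rewrite ler_pM2l.
  rewrite /K divfK ?gt_eqF// -mulrA ltr_pMl ?mulr_gt0// ltr1n//.
Qed.

End Subspaces.

Section Blowups.
Context {R : realType} {m : nat}.

(** The blow-ups of f at o converge to its differential uniformly on balls. *)
Lemma differentiable_blowup (f : 'rV[R]_m -> 'rV[R]_m) (o : 'rV[R]_m)
    (N rho : R) : differentiable f o -> 0 < N -> 0 < rho ->
  \forall r \near 0^'+, forall w, enorm w < N ->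
    enorm (blowup (f o) r (f (o + r *: w)) - 'd f o w) <= rho.
Proof.
move=> df N0 rho0; have [_ /eqaddoP E] := (diff_locallyP o f).1 df.
have [C C0 HC] := enorm_le_norm (R := R) m.
have eps0 : 0 < rho / (C * N) by rewrite divr_gt0// mulr_gt0.
have [eta eta0 heta] := nbhs_enorm (E _ eps0).
near=> r => w wN.
have r0 : 0 < r by near: r; exact: nbhs_right_gt.
have rN : r * N < eta.
  by rewrite -ltr_pdivlMr//; near: r; apply: nbhs_right_lt; rewrite divr_gt0.
have rw : enorm (r *: w) < r * N by rewrite enormZ gtr0_norm// ltr_pM2l.
have := heta (r *: w); rewrite subr0 => /(_ (lt_trans rw rN)).
rewrite /= !fctE /= linearZ /= => h.
have -> : blowup (f o) r (f (o + r *: w)) - 'd f o w =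
    r^-1 *: (f (r *: w + o) - (f o + r *: 'd f o w)).
  rewrite /blowup (addrC o) [in RHS]opprD [in RHS]addrA [RHS]scalerBr.
  by rewrite scalerA mulVf ?gt_eqF// scale1r.
rewrite enormZ gtr0_norm ?invr_gt0// ler_pdivrMl//.
apply: (le_trans (HC _)); rewrite mulrC -ler_pdivlMr//.
apply: (le_trans h).
apply: (@le_trans _ _ (rho / (C * N) * (r * N))).
  rewrite ler_pM2l//; apply/ltW; apply: le_lt_trans rw; exact: le_norm_enorm.
rewrite le_eqVlt; apply/orP; left; apply/eqP; field.
by rewrite !gt_eqF.
Unshelve. all: by end_near. Qed.

End Blowups.

Section ChartEstimates.
Context {R : realType} {m : nat} {M : smoothManifold R m}.
Variables (g : riemannianMetric M) (k : nat).
Implicit Types (phi psi : chart R m M) (x : M) (S E : set M).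

(** A linear map carries the estimates for an isometric chart to an arbitrary
    one. *)
Lemma chart_bilipschitz phi x : charts_at x phi ->
  exists delta C, [/\ 0 < delta, 0 < C &
    forall p q, chart_dom phi p -> chart_dom phi q ->
      enorm (phi p - phi x) < delta -> enorm (phi q - phi x) < delta ->
      ((C^-1 * enorm (phi p - phi q))%:E <= riemannian_dist g p q /\
       riemannian_dist g p q <= (C * enorm (phi p - phi q))%:E)%E].
Proof.
have half : 0 < (1 / 2 : R) < 1 by apply/andP; split; lra.
move=> hphi; have [A [psi [Au iso dE psiE _]]] := isometric_chart_exists g hphi.
have [[apsi dx] _] := iso.
have [d d0 pinch] := isometric_chart_pinched iso half.
have [C1 C10 HC1] :=
  linear_enorm_bounded (mulmxr A : {linear 'rV[R]_m -> 'rV[R]_m}).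
have [C2 C20 HC2] :=
  linear_enorm_bounded (mulmxr (invmx A) : {linear 'rV[R]_m -> 'rV[R]_m}).
have psiB p q : psi p - psi q = mulmxr A (phi p - phi q).
  by rewrite !psiE /= mulmxBl.
have phiB p q : phi p - phi q = mulmxr (invmx A) (psi p - psi q).
  by rewrite psiB /= mulmxK.
exists (d / 4 / C1), (2 * C1 + 2 * C2); split.
- by rewrite !divr_gt0.
- by rewrite addr_gt0// mulr_gt0.
move=> p q dp dq px qx.
have close z : enorm (phi z - phi x) < d / 4 / C1 ->
    enorm (psi z - psi x) < d / 4.
  rewrite ltr_pdivlMr// mulrC => h; apply: le_lt_trans h.
  by rewrite psiB; exact: HC1.
rewrite -dE in dp dq; clear dE.
have px' := close _ px; have qx' := close _ qx.
have lo := riemannian_dist_ge apsi pinch (_ : 0 < 1 - 1 / 2) dp dq px' qx'.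
have hi := riemannian_dist_le apsi pinch (_ : 0 <= 1 + 1 / 2) dp dq px' qx'.
have n0 := enorm_ge0 (phi p - phi q); have n0' := enorm_ge0 (psi p - psi q).
have Cpos : 0 < 2 * C1 + 2 * C2 by rewrite addr_gt0// mulr_gt0.
split.
  apply: le_trans (lo _); last by lra.
  have h : enorm (phi p - phi q) <= C2 * enorm (psi p - psi q).
    by rewrite {1}(phiB p q); exact: HC2.
  rewrite lee_fin ler_pdivrMl//.
  apply: (le_trans h); rewrite mulrA; apply: ler_wpM2r => //; lra.
apply: le_trans (hi _) _; first by lra.
have h : enorm (psi p - psi q) <= C1 * enorm (phi p - phi q).
  by rewrite {1}(psiB p q); exact: HC1.
rewrite lee_fin.
have c : (1 + 1 / 2) * C1 <= 2 * C1 + 2 * C2 by lra.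
apply: (@le_trans _ _ ((1 + 1 / 2) * C1 * enorm (phi p - phi q))).
  by rewrite -mulrA ler_pM2l//; lra.
exact: ler_wpM2r.
Qed.

Lemma chart_blowup_transition phi psi x (r : R) z : 0 < r -> charts_at x phi ->
  chart_dom phi z ->
  blowup (psi x) r (transition phi psi (phi x + r *: chart_blowup phi x r z)) =
  chart_blowup psi x r z.
Proof.
move=> r0 hphi dz; rewrite /chart_blowup blowupK//.
by rewrite /transition /= chart_mapK.
Qed.

(** Sets that are small in coordinates are small in M, because the inverse
    chart is continuous. *)
Lemma near_chart phi x (W : set M) : charts_at x phi -> nbhs x W ->
  exists2 eta, 0 < eta &
    forall z, chart_dom phi z -> enorm (phi z - phi x) < eta -> W z.
Proof.
move=> [aphi dx] xW.
have imx : (phi @` chart_dom phi) (phi x) by exists x.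
have : nbhs (chart_inv phi (phi x)) W by rewrite chart_mapK.
move=> /(chart_inv_continuous imx); rewrite nbhs_simpl/=.
move=> /nbhs_enorm[eta eta0 h]; exists eta => // z dz /h /=.
by rewrite chart_mapK.
Qed.

Lemma nbhs_chart_ball phi x (delta : R) : charts_at x phi -> 0 < delta ->
  nbhs x [set z | chart_dom phi z /\ enorm (phi z - phi x) < delta].
Proof.
move=> [aphi dx] d0; apply: filterI.
  by apply: open_nbhs_nbhs; split => //; exact: chart_dom_open.
by have := chart_map_continuous dx (enorm_nbhs (phi x) d0).
Qed.

End ChartEstimates.

Section Bumps.
Context {R : realType} {m : nat}.

Lemma test_function_bump (L L' : {linear 'rV[R]_m -> 'rV[R]_m}) (v : 'rV[R]_m)
    (rho : R) : 0 < rho -> cancel L L' ->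
  test_function (fun w => Num.max (rho - enorm (L w - v)) 0).
Proof.
move=> rho0 LK; have [C C0 HC] := linear_enorm_bounded L'.
split.
  move=> w; apply: (@continuous_max _ _ (fun w => rho - enorm (L w - v)) (cst 0)).
    apply: continuousB; first exact: cst_continuous.
    apply: (@continuous_comp _ _ _ (fun w => L w - v) (@enorm R m)).
      apply: continuousB; last exact: cst_continuous.
      exact: linear_rV_continuous.
    exact: continuous_enorm.
  exact: cst_continuous.
exists (C * (rho + enorm v)); first by rewrite mulr_gt0// ltr_wpDr// enorm_ge0.
move=> w; have [_|] := leP (rho - enorm (L w - v)) 0; first by rewrite eqxx.
rewrite subr_gt0 => /ltW wr _; rewrite -(LK w).
apply: (le_trans (HC _)); rewrite ler_pM2l// -[L w](subrK v).
by apply: (le_trans (enormD _ _)); rewrite lerD2r.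
Qed.

Lemma weak_star_cvg_posint (mu : R -> set 'rV[R]_m -> \bar R) nu f :
  (forall r, nonneg_set_function (mu r)) -> nonneg_set_function nu ->
  weak_star_cvg mu nu -> test_function f -> (forall z, 0 <= f z) ->
  posint (mu r) f @[r --> 0^'+] --> posint nu f.
Proof.
move=> hmu hnu /weak_star_cvg_test munu tf f0.
have := munu f tf; rewrite integral_rV_ge0//.
have -> // : (fun r => integral_rV (mu r) f) = fun r => posint (mu r) f.
by apply/funext => r; rewrite integral_rV_ge0.
Qed.

End Bumps.

Section Support.
Context {R : realType} {m : nat} {M : smoothManifold R m}.
Variables (g : riemannianMetric M) (k : nat).
Implicit Types (phi psi : chart R m M) (x : M) (S E : set M).

Local Notation blowup_measure phi S x := (fun r =>
  Defs.mrestrict (hausdorff Defs.edist k) (blowup (phi x) r @` chart_image phi S)).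

(** The transition map is only meaningful on the overlap, and the blow-ups of
    its domain exhaust the space; the bound N makes the differential a uniform
    approximation. *)
Definition overlap_window phi psi x (N r : R) : set 'rV[R]_m :=
  [set w | enorm w < N /\ overlap phi psi (phi x + r *: w)].

Definition blowup_transition phi psi x (r : R) (w : 'rV[R]_m) : 'rV[R]_m :=
  blowup (psi x) r (transition phi psi (phi x + r *: w)).

(** Both charts are bi-Lipschitz for the Riemannian distance near x, so that
    the two Euclidean Hausdorff measures dominate each other, at the same
    scale, up to a constant. The points that psi blows up into the ball of
    radius N are blown up by phi into a ball whose radius is N times the
    Lipschitz constants of the two charts. *)
Lemma blowup_measure_transfer phi psi x S (N : R) :
  charts_at x phi -> charts_at x psi -> 0 < N ->
  exists C N' : R, [/\ 0 <= C, 0 < N' & \forall r \near 0^'+,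
    forall B, B `<=` [set w : 'rV[R]_m | enorm w <= N] ->
    (blowup_measure psi S x r B <= C%:E * blowup_measure phi S x r
      (overlap_window phi psi x N' r `&` blowup_transition phi psi x r @^-1` B))%E].
Proof.
move=> hphi hpsi N0.
have [d1 [C1 [d10 C10 bi1]]] := chart_bilipschitz g hphi.
have [d2 [C2 [d20 C20 bi2]]] := chart_bilipschitz g hpsi.
have dphi : chart_dom phi x by case: hphi.
have dpsi : chart_dom psi x by case: hpsi.
exists ((C2 * C1) ^+ k), (C1 * C2 * N + 1).
split; first by rewrite exprn_ge0// mulr_ge0// ltW.
  by rewrite ltr_pwDr// !mulr_ge0// ltW.
have W1 := nbhs_chart_ball hphi d10; have W2 := nbhs_chart_ball hpsi d20.
have [eta eta0 heta] := near_chart hpsi (filterI W1 W2).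
near=> r => B BN.
have r0 : 0 < r by near: r; exact: nbhs_right_gt.
have rN : r * N < eta.
  by rewrite -ltr_pdivlMr//; near: r; apply: nbhs_right_lt; rewrite divr_gt0.
set E := S `&` (chart_dom psi `&` (blowup (psi x) r \o psi) @^-1` B).
have EN z : E z -> enorm (psi z - psi x) <= r * N.
  move=> [_ [_ /BN /=]]; rewrite enorm_blowup// ler_pdivrMl//.
have EW z : E z -> (chart_dom phi z /\ enorm (phi z - phi x) < d1) /\
    (chart_dom psi z /\ enorm (psi z - psi x) < d2).
  by move=> Ez; apply: heta; [case: Ez => _ []|exact: le_lt_trans (EN z Ez) rN].
have -> : blowup_measure psi S x r B =
    hausdorff Defs.edist k (chart_blowup psi x r @` E).
  by rewrite /Defs.mrestrict chart_image_blowupE.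
have step1 := @hausdorff_chart_blowup_le R m M g k psi x E r C2^-1 r0.
apply: le_trans (step1 _ _) _; first by rewrite invr_gt0.
  by move=> p q /EW[_ [p1 p2]] /EW[_ [q1 q2]]; have [] := bi2 p q p1 q1 p2 q2.
have step2 := @hausdorff_chart_blowup_ge R m M g k phi x E r C1 r0 C10.
apply: (@le_trans _ _ (((r * C2^-1) ^- k)%:E * (((r * C1) ^+ k)%:E *
    hausdorff Defs.edist k (chart_blowup phi x r @` E)))%E).
  apply: lee_wpmul2l.
    by rewrite lee_fin invr_ge0 exprn_ge0// mulr_ge0 ?invr_ge0 ?ltW.
  apply: step2; first by move=> z /EW[[]].
  by move=> p q /EW[[p1 p2] _] /EW[[q1 q2] _]; have [] := bi1 p q p1 q1 p2 q2.
rewrite muleA -EFinM -exprVn -exprMn.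
have -> : (r * C2^-1)^-1 * (r * C1) = C2 * C1.
  by field; rewrite !gt_eqF.
apply: lee_wpmul2l; first by rewrite lee_fin exprn_ge0// mulr_ge0// ltW.
apply: hausdorff_le => _ [z Ez <-].
have [[dz z1] [dz' z2]] := EW z Ez; have [Sz [_ Bz]] := Ez.
split; first by exists (phi z) => //; exists z.
split; last by rewrite /= /blowup_transition chart_blowup_transition.
split; last by rewrite /chart_blowup blowupK//; exists z.
rewrite /chart_blowup enorm_blowup// ltr_pdivrMl//.
have x1 : enorm (phi x - phi x) < d1 by rewrite subrr enorm0.
have x2 : enorm (psi x - psi x) < d2 by rewrite subrr enorm0.
have [lo _] := bi1 z x dz dphi z1 x1; have [_ hi] := bi2 z x dz' dpsi z2 x2.
have := le_trans lo hi; rewrite lee_fin ler_pdivrMl// => h.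
apply: (le_lt_trans h).
apply: (@le_lt_trans _ _ (C1 * (C2 * (r * N)))).
  by rewrite ler_pM2l// ler_pM2l//; exact: EN.
have -> : C1 * (C2 * (r * N)) = r * (C1 * C2 * N) by ring.
by rewrite ltr_pM2l// ltrDl.
Unshelve. all: by end_near. Qed.

(** Let f be a bump around v, and f' a twice larger bump around v read through
    the differential L of the transition map. The blow-ups of the transition
    map are close to L, so that the integral of f in the chart psi is dominated
    by that of f' in the chart phi. The latter tends to 0, since f' vanishes on
    T, whose image under L stays away from v. *)
Lemma approx_tangent_support phi psi x S (T T2 : {vspace 'rV[R]_m}) v :
  charts_at x phi -> charts_at x psi ->
  is_approx_tangent k (chart_image phi S) (phi x) T ->
  is_approx_tangent k (chart_image psi S) (psi x) T2 ->
  v \notin (linfun ('d (transition phi psi) (phi x)) @: T)%VS ->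
  exists2 rho, 0 < rho & hausdorff Defs.edist k
    ([set` T2] `&` [set w | enorm (w - v) < rho]) = 0%E.
Proof.
move=> hphi hpsi [_ cT] [_ cT2] vT.
have dtau := transition_differentiable hphi hpsi.
set L : {linear 'rV[R]_m -> 'rV[R]_m} := 'd (transition phi psi) (phi x).
pose L' : {linear 'rV[R]_m -> 'rV[R]_m} := 'd (transition psi phi) (psi x).
have LK : cancel L L'.
  move=> u; rewrite /L /L'.
  by rewrite (diff_transition_comp u hphi hpsi hphi) diff_transition_id.
have [d d0 sep] := vspace_separated vT.
(* The larger bump f' has radius 2 rho = d, hence vanishes on T. *)
pose rho := d / 2.
have rho0 : 0 < rho by rewrite divr_gt0.
pose f w := Num.max (rho - enorm (w - v)) 0.
pose f' w := Num.max (2 * rho - enorm (L w - v)) 0.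
have tf : test_function f.
  have idK : cancel (idfun : 'rV[R]_m -> 'rV[R]_m) idfun by [].
  exact: (@test_function_bump _ _ idfun idfun v rho rho0 idK).
have tf' : test_function f'.
  by apply: (test_function_bump (L' := L')) => //; rewrite mulr_gt0.
have f0 w : 0 <= f w by rewrite le_max lexx orbT.
have f'0 w : 0 <= f' w by rewrite le_max lexx orbT.
have mh (D : set 'rV[R]_m) := nonneg_hausdorff k D.
have cf := weak_star_cvg_posint (fun r => mh _) (mh _) cT2 tf f0.
have := weak_star_cvg_posint (fun r => mh _) (mh _) cT tf' f'0.
rewrite (posint_null (f := f') (mh [set` T])); last first.
  move=> B Bf'; rewrite /Defs.mrestrict (_ : _ `&` B = set0).
    exact: hausdorff0 (@euclidean_dist_ge0 _ _).
  rewrite -subset0 => t [/= tT /Bf' /=]; rewrite lt_max ltxx orbF subr_gt0.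
  have : L t \in (linfun L @: T)%VS by rewrite -(lfunE L); exact: memv_img.
  move=> /sep; rewrite /rho mulrC divfK// => h1 h2.
  by have := le_lt_trans h1 h2; rewrite ltxx.
move=> cf'.
have N0 : 0 < enorm v + rho by rewrite ltr_wpDl// enorm_ge0.
have [C [N' [C0 N'0 transfer]]] := blowup_measure_transfer S hphi hpsi N0.
have close := differentiable_blowup dtau N'0 rho0.
have le_int : \forall r \near 0^'+,
    (posint (blowup_measure psi S x r) f <=
     C%:E * posint (blowup_measure phi S x r) f')%E.
  near=> r.
  have r0 : 0 < r by near: r; exact: nbhs_right_gt.
  pose line (w : 'rV[R]_m) := phi x + r *: w.
  have cline : continuous line.
    move=> w; apply: (@continuousD _ _ _ (cst (phi x)) ( *:%R r)).
      exact: cst_continuous.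
    exact: scaler_continuous.
  have oov : open (overlap phi psi).
    by apply: open_overlap; [case: hphi|case: hpsi].
  apply: (@posint_transfer R m (blowup_measure psi S x r)
    (blowup_measure phi S x r) (blowup_transition phi psi x r)
    (overlap_window phi psi x N' r) C f f' C0 (mh _) (mh _)).
  - apply: openI.
      apply: (@open_comp _ _ (@enorm R m) [set y | y < N']); last exact: open_lt.
      by move=> w _; exact: continuous_enorm.
    by apply: (@open_comp _ _ line) => // w _; exact: cline.
  - move=> w [_ ov].
    have [dt _] := overlap_diff (proj1 hphi) (proj1 hpsi) ov.
    have c1 := continuous_comp (cline w) (differentiable_continuous dt).
    have c2 : {for transition phi psi (line w), continuous (blowup (psi x) r)}.
      rewrite /blowup; apply: continuous_comp; last exact: scaler_continuous.
      by apply: continuousB; [exact: cvg_id|exact: cst_continuous].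
    exact: (continuous_comp c1 c2).
  - move=> B Bf.
    have : forall B, B `<=` [set w : 'rV[R]_m | enorm w <= enorm v + rho] ->
      (blowup_measure psi S x r B <= C%:E * blowup_measure phi S x r
        (overlap_window phi psi x N' r `&` blowup_transition phi psi x r @^-1` B))%E.
      by near: r.
    apply=> w /Bf /=; rewrite lt_max ltxx orbF subr_gt0 => wv.
    rewrite -[w](subrK v); apply: (le_trans (enormD _ _)).
    by rewrite [leLHS]addrC lerD2l ltW.
  - move=> w [wN' _].
    have : forall w, enorm w < N' -> enorm (blowup (transition phi psi (phi x)) r
        (transition phi psi (phi x + r *: w)) - L w) <= rho.
      by near: r.
    move=> /(_ w wN'); rewrite (transitionE psi hphi) -/(line w).
    rewrite -[blowup _ _ _]/(blowup_transition phi psi x r w).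
    set y := blowup_transition _ _ _ _ _ => yL.
    rewrite /f ge_max f'0 andbT le_max; apply/orP; left.
    rewrite lerBrDr addrAC lerBlDr.
    have -> : L w - v = (y - v) + (L w - y).
      by rewrite [RHS]addrC [RHS]addrA subrK.
    have := enormD (y - v) (L w - y); rewrite (enormB (L w)); lra.
have lim0 :
    (posint (Defs.mrestrict (hausdorff Defs.edist k) [set` T2]) f <= 0)%E.
  rewrite -(cvg_lim _ cf)//.
  have cf'' :
      (C%:E * posint (blowup_measure phi S x r) f' @[r --> 0^'+] --> 0)%E.
    by rewrite -(mule0 C%:E); exact: cvgeZl.
  rewrite -(cvg_lim _ cf'')//; apply: lee_lim.
  - by apply/cvg_ex; eexists; exact: cf.
  - by apply/cvg_ex; eexists; exact: cf''.
  - exact: le_int.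
exists (rho / 2); first by rewrite divr_gt0.
pose B := [set w : 'rV[R]_m | enorm (w - v) < rho / 2].
have oB : open B.
  rewrite (_ : B = (fun w : 'rV[R]_m => enorm (w - v)) @^-1`
                     [set y | y < rho / 2])//.
  apply: open_comp; last exact: open_lt.
  move=> w _; apply: (@continuous_comp _ _ _ (fun w : 'rV[R]_m => w - v)).
    by apply: continuousB; [exact: cvg_id|exact: cst_continuous].
  exact: continuous_enorm.
have rho20 : 0 <= rho / 2 by rewrite ltW// divr_gt0.
have Bf w : B w -> rho / 2 <= f w.
  by rewrite /B /= => wv; rewrite le_max; apply/orP; left; lra.
have le0 := le_trans (posint_ge (mh [set` T2]) oB rho20 Bf) lim0.
rewrite pmule_rle0 ?lte_fin ?divr_gt0// in le0.
apply/eqP; rewrite eq_le; apply/andP; split; first exact: le0.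
by have [_] := mh [set` T2]; exact.
Unshelve. all: by end_near. Qed.

End Support.

(** * The equivalence *)

Section ChartDifferential.
Context {R : realType} {m : nat} {M : smoothManifold R m}.
Implicit Types (phi psi : chart R m M) (x : M).

Lemma lker_chart_diff phi x : charts_at x phi -> lker (chart_diff phi x) == 0%VS.
Proof.
move=> hphi; apply/lker0P => v w; rewrite !chart_diffE.
exact: tangent_coord_inj hphi.
Qed.

Lemma chart_diff_invK phi x : charts_at x phi ->
  cancel (chart_diff phi x)^-1%VF (chart_diff phi x).
Proof.
move=> hphi u; apply: limg_lfunVK.
rewrite -(vec_of_coordK u hphi) -chart_diffE; exact: memv_img (memvf _).
Qed.

Lemma dim_chart_diff phi x (T : {vspace tangent M x}) : charts_at x phi ->
  \dim (chart_diff phi x @: T) = \dim T.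
Proof.
move=> hphi; apply: limg_dim_eq.
by rewrite (eqP (lker_chart_diff hphi)) capv0.
Qed.

Lemma chart_diff_inv_img phi x (T : {vspace tangent M x}) : charts_at x phi ->
  ((chart_diff phi x)^-1 @: (chart_diff phi x @: T))%VS = T.
Proof.
move=> hphi; rewrite -limg_comp (lker0_compVf (lker_chart_diff hphi)).
exact: lim1g.
Qed.

Lemma linfun_transition_sub phi psi x (T' : {vspace 'rV[R]_m}) :
  charts_at x phi -> charts_at x psi ->
  (linfun ('d (transition phi psi) (phi x)) @: T' <=
   chart_diff psi x @: ((chart_diff phi x)^-1 @: T'))%VS.
Proof.
move=> hphi hpsi; apply/subvP => _ /memv_imgP[t tT' ->]; rewrite lfunE /=.
set v := (chart_diff phi x)^-1%VF t.
have vt : v phi = t by rewrite -chart_diffE chart_diff_invK.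
have /asboolP[_ /(_ phi psi hphi hpsi) vpsi] := tangent_coordP v.
rewrite -vt -vpsi -chart_diffE; apply: memv_img; exact: memv_img.
Qed.

End ChartDifferential.

Section Convergence.
Context {R : realType} {m : nat} (k : nat).

Lemma locally_asymp_equiv_sym (mu mu' : R -> set 'rV[R]_m -> \bar R) :
  locally_asymp_equiv mu mu' -> locally_asymp_equiv mu' mu.
Proof.
move=> h rho e rho0 e0; have := h rho e rho0 e0; apply: filterS => r hr B Br.
by have [] := hr B Br.
Qed.

(** If one subspace has a null ball, all subspaces of the same dimension are
    null on bounded sets, such as the set where a test function does not
    vanish. *)
Lemma integral_null_subspace (T T' : {vspace 'rV[R]_m}) (v : 'rV[R]_m) rho f :
  \dim T = \dim T' -> v \in T -> 0 < rho ->
  hausdorff Defs.edist k ([set` T] `&` [set w | enorm (w - v) < rho]) = 0%E ->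
  test_function f ->
  integral_rV (Defs.mrestrict (hausdorff Defs.edist k) [set` T']) f = 0%E.
Proof.
move=> dimE vT rho0 null tf.
have pos0 h : test_function h ->
    posint (Defs.mrestrict (hausdorff Defs.edist k) [set` T']) h = 0%E.
  move=> [_ [N N0 hN]]; apply: posint_null; first exact: nonneg_hausdorff.
  move=> B Bh; apply/eqP; rewrite eq_le; apply/andP; split; last first.
    by have [_] := nonneg_hausdorff k [set` T']; exact.
  rewrite -(hausdorff_null_subspaces dimE vT rho0 N0 null).
  apply: hausdorff_le => w [Tw /Bh /= hw]; split=> //.
  by apply: hN; rewrite gt_eqF.
by rewrite integral_rVE !pos0// ?sube0//; exact: test_functionN.
Qed.

End Convergence.

Theorem lemma5p13 (R : realType) (m k : nat) (M : smoothManifold R m)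
    (M_connected : connected [set: M]) (M_oriented : orientation M)
    (g : riemannianMetric M) (S : set M) (x : M)
    (S_locally_finite : locally_finite_hausdorff g k S) (Sx : S x)
    (S_chart_independent : approx_tangent_chart_independent k S x)
    (T : {vspace tangent M x}) (T_dim : \dim T = k) :
  has_approx_tangent k S T <->
  forall phi : chart R m M, charts_at x phi ->
    weak_star_cvg (rescaled_pushforward g k phi S x)
                  (tangent_pushforward g k phi T).
Proof.
have hmu (psi : chart R m M) (r : R) :
    nonneg_set_function (Defs.mrestrict (hausdorff Defs.edist k)
      (blowup (psi x) r @` chart_image psi S)) by exact: nonneg_hausdorff.
have hmu' psi (r : R) :
    nonneg_set_function (rescaled_pushforward g k psi S x `|r|).
  exact: nonneg_rescaled_pushforward.
split=> [[phi0 [T0 [hphi0 aT0 TE]]] phi hphi|cvgT].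
  have [A [psi [Au iso dE psiE vE]]] := isometric_chart_exists g hphi.
  have hpsi : charts_at x psi by case: iso.
  apply: (weak_star_cvg_linear_chart Au dE psiE vE).
  apply/weak_star_cvg_norm; rewrite (tangent_pushforward_isometric _ _ iso).
  apply: (weak_star_cvg_asymp_equiv (hmu psi) (hmu' psi) _
    (locally_asymp_equiv_chart k S iso)); first exact: nonneg_hausdorff.
  have ex0 : exists2 phi, charts_at x phi & has_approx_tangent_in k phi S x.
    by exists phi0 => //; exists T0.
  have [T2 aT2] := S_chart_independent ex0 psi hpsi.
  have [dimT2 cvgT2] := aT2.
  set T1 := (chart_diff psi x @: T)%VS.
  have dimT1 : \dim T1 = k by rewrite dim_chart_diff.
  have [T21|/subvPn[v vT2 vT1]] := boolP (T2 <= T1)%VS.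
    suff <- : T2 = T1 by [].
    by apply/eqP; rewrite eqEdim T21 dimT1 dimT2 leqnn.
  have vL : v \notin (linfun ('d (transition phi0 psi) (phi0 x)) @: T0)%VS.
    apply: contra vT1; rewrite /T1 TE.
    exact: (subvP (linfun_transition_sub T0 hphi0 hpsi)).
  have [rho rho0 null] := approx_tangent_support g hphi0 hpsi aT0 aT2 vL.
  apply/weak_star_cvg_test => f tf.
  move/weak_star_cvg_test/(_ f tf): cvgT2.
  by rewrite !(integral_null_subspace _ vT2 rho0 null tf)// dimT2.
have hphi := chart_aroundP x.
have [A [psi [Au iso dE psiE vE]]] := isometric_chart_exists g hphi.
have hpsi : charts_at x psi by case: iso.
exists psi, (chart_diff psi x @: T)%VS; split=> //.
  split; first by rewrite dim_chart_diff.
  have := cvgT psi hpsi; rewrite (tangent_pushforward_isometric _ _ iso).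
  move/weak_star_cvg_norm.
  apply: (weak_star_cvg_asymp_equiv (hmu' psi) (hmu psi)).
    exact: nonneg_hausdorff.
  exact: locally_asymp_equiv_sym (locally_asymp_equiv_chart k S iso).
by rewrite chart_diff_inv_img.
Qed.
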